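(* Let $\mathcal G$ be a non-empty connected oriented graph with finite vertex set $\mathcal V$, countable oriented edge set $\mathcal E$, and length function $\ell:\mathcal E\to(0,\infty)$, satisfying: (H1) for all $\sigma>0$, $\sum_{e\in\mathcal E}e^{-\sigma\ell(e)}<\infty$; (H2) for all edges $e,e'\in\mathcal E$ there exists a path in $\mathcal G$ which starts with $e$ and ends with $e'$; (H3) there is no $d>0$ such that $\{\ell(c): c \text{ is a closed path}\}\subset d\mathbb N$. Let $x\in\mathcal V$ and let $h=h(\mathcal G,\ell,x)$ be the volume entropy. Then there exists a constant $C>0$ such that $$\lim_{R\to+\infty}\frac{N_{\mathcal G}(x,R)}{e^{hR}}=C.$$
   Context: Oriented graphs may have loops and multiple edges (even infinitely many between two vertices). For an edge $e$, $i(e)$ and $t(e)$ denote its initial and terminal vertices. A path is a finite sequence of edges $p=e_1\ldots e_n$ with $t(e_j)=i(e_{j+1})$ for $1\le j<n$; its length is $\ell(p)=\sum_{j=1}^n\ell(e_j)$. A path is closed if $t(e_n)=i(e_1)$. For $x\in\mathcal V$ and $R>0$, $N_{\mathcal G}(x,R)$ is the number of paths $p=e_1\ldots e_n$ with $i(e_1)=x$ and $\ell(p)\le R$. The volume entropy is $$h(\mathcal G,\ell,x)=\limsup_{R\to+\infty}\frac1R\log N_{\mathcal G}(x,R).$$ Under (H1)-(H3) it does not depend on the choice of $x$. *)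

(* Defs.v *)
From HB Require Import structures.
From mathcomp Require Import all_boot all_order all_algebra.
From mathcomp Require Import all_classical all_reals all_analysis.

Set Implicit Arguments.
Unset Strict Implicit.
Unset Printing Implicit Defensive.

Import Order.TTheory GRing.Theory Num.Theory.
Import numFieldNormedType.Exports.

Local Open Scope classical_set_scope.
Local Open Scope ring_scope.

(* Loops and (possibly infinitely many) parallel edges are allowed. *)
Record ograph (V : finType) (E : countType) := OGraph {
  ini : E -> V;
  ter : E -> V
}.

Definition adjacent (V : finType) (E : countType) (G : ograph V E) : rel V :=
  [rel u v | `[< exists e : E,
     (ini G e = u /\ ter G e = v) \/ (ini G e = v /\ ter G e = u) >]].

(* Connectedness of the underlying unoriented graph. *)
Definition connected_ograph (V : finType) (E : countType) (G : ograph V E) :=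
  forall u v : V, connect (adjacent G) u v.

(* The empty sequence is not a path. *)
Definition is_path (V : finType) (E : countType) (G : ograph V E)
    (p : seq E) : bool :=
  if p is e :: q then path (fun a b => ter G a == ini G b) e q else false.

Definition path_starts (V : finType) (E : countType) (G : ograph V E) (x : V)
    (p : seq E) : bool :=
  if p is e :: _ then ini G e == x else false.

Definition is_closed_path (V : finType) (E : countType) (G : ograph V E)
    (p : seq E) : bool :=
  is_path G p && (if p is e :: q then ter G (last e q) == ini G e else false).

Definition path_length (R : realType) (E : countType) (ell : E -> R)
    (p : seq E) : R := \sum_(e <- p) ell e.

(* Extended-real valued: +oo if there are infinitely many such paths. *)
Definition num_paths (R : realType) (V : finType) (E : countType)
    (G : ograph V E) (ell : E -> R) (x : V) (r : R) : \bar R :=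
  counting [set p : seq E |
    [/\ is_path G p, path_starts G x p & path_length ell p <= r]].

Definition volume_entropy (R : realType) (V : finType) (E : countType)
    (G : ograph V E) (ell : E -> R) (x : V) : \bar R :=
  limf_esup (fun r : R => ((r^-1)%:E * lne (num_paths G ell x r))%E) +oo%R.

(* Main.v *)
(** Let a(e) = exp(-h l(e)), where h is the exponent for which the matrix
    A_yz = sum of a(e) over the edges e from y to z has a positive left
    eigenvector w with eigenvalue 1; it is the infimum of the exponents s that
    admit a strictly subinvariant positive row vector, and two non-commuting
    loops force it to be positive.  If N_y(r) counts the paths from y of length
    at most r (including the empty one), then f_y(r) = exp(-hr) N_y(r) satisfies
    the renewal equation f_y(r) = exp(-hr) + sum of a(e) f_{t(e)}(r - l(e)) over
    the edges e leaving y.  Where f_y is close to its limsup M_y, every term of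
    this average is close to its own limsup, because w is invariant; following
    paths, whose lengths are eventually dense by (H3), one finds arbitrarily long
    windows on which all f_z are close to M_z, and likewise for the liminfs m_z.
    Pairing with w gives a conservation law: the sum over all edges of
    w(i(e)) a(e) times the integral of f_{t(e)} over [r - l(e), r] depends only
    on r and has a positive limit.  Evaluating it on both kinds of windows gives
    M = m > 0. *)

Require Import Defs.
From HB Require Import structures.
From mathcomp Require Import all_boot all_order all_algebra finmap.
From mathcomp Require Import all_classical all_reals all_analysis.
From mathcomp Require Import ring lra.

Set Implicit Arguments.
Unset Strict Implicit.
Unset Printing Implicit Defensive.

Import Order.TTheory GRing.Theory Num.Theory.
Import numFieldNormedType.Exports.

Local Open Scope classical_set_scope.
Local Open Scope ring_scope.

(** * Sums of nonnegative families *)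

Section HasSum.
Variables (R : realType) (T : choiceType).
Implicit Types (k : T -> R) (s : {fset T}) (v : R).

(** Nonnegativity makes [esum] the supremum of the finite partial sums; asking it to equal a real
    number records convergence and value together. *)
Definition has_sum k v :=
  (forall t, 0 <= k t) /\ (\esum_(t in [set: T]) (k t)%:E = v%:E)%E.

Lemma fsbig_fset k s :
  (\sum_(t \in [set` s]) (k t)%:E = (\sum_(t <- s) k t)%:E)%E.
Proof. by rewrite fsbig_finite//= set_fsetK sumEFin. Qed.

Lemma esum_fset_le k v :
  (forall s, \sum_(t <- s) k t <= v) ->
  (\esum_(t in [set: T]) (k t)%:E <= v%:E)%E.
Proof.
move=> kv; apply: ge_ereal_sup => _ /= [X [finX _] <-].
by rewrite -(fset_setK finX) fsbig_fset lee_fin.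
Qed.

Lemma fset_le_esum k s :
  ((\sum_(t <- s) k t)%:E <= \esum_(t in [set: T]) (k t)%:E)%E.
Proof.
by apply: ereal_sup_ubound; exists [set` s]; [split|rewrite fsbig_fset].
Qed.

Lemma fin_has_sum k : (forall t, 0 <= k t) ->
  (\esum_(t in [set: T]) (k t)%:E < +oo)%E -> exists v, has_sum k v.
Proof.
move=> k0 klt; exists (fine (\esum_(t in [set: T]) (k t)%:E)); split=> //.
rewrite fineK// fin_numElt klt andbT; apply: (@lt_le_trans _ _ 0%E) => //.
by apply: esum_ge0 => t _; rewrite lee_fin.
Qed.

Lemma has_sum_ge_fset k v s : has_sum k v -> \sum_(t <- s) k t <= v.
Proof. by case=> _ kv; rewrite -lee_fin -kv fset_le_esum. Qed.

Lemma has_sum_le k v b : has_sum k v ->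
  (forall s, \sum_(t <- s) k t <= b) -> v <= b.
Proof. by case=> _ kv kb; rewrite -lee_fin -kv esum_fset_le. Qed.

Lemma has_sum_ex k b : (forall t, 0 <= k t) ->
  (forall s, \sum_(t <- s) k t <= b) -> exists2 v, has_sum k v & v <= b.
Proof.
move=> k0 kb; have [|v kv] := fin_has_sum k0.
  by apply: le_lt_trans (esum_fset_le kb) _; rewrite ltry.
by exists v => //; apply: has_sum_le kb.
Qed.

Lemma has_sum_ge0 k v : has_sum k v -> 0 <= v.
Proof. by move=> /(has_sum_ge_fset fset0); rewrite big_seq_fset0. Qed.

Lemma has_sum_ge_term k v t : has_sum k v -> k t <= v.
Proof. by move=> /(has_sum_ge_fset [fset t]%fset); rewrite big_seq_fset1. Qed.

Lemma has_sumB k v k' v' : has_sum k v -> has_sum k' v' ->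
  (forall t, k' t <= k t) -> has_sum (fun t => k t - k' t) (v - v').
Proof.
move=> [k0 kv] [k'0 kv'] k'k.
have d0 t : 0 <= k t - k' t by rewrite subr_ge0.
have kE : (\esum_(t in [set: T]) (k t)%:E =
    \esum_(t in [set: T]) (k t - k' t)%:E + v'%:E)%E.
  rewrite -kv' -esumD//; last 2 first.
  - by move=> t _; rewrite lee_fin.
  - by move=> t _; rewrite lee_fin.
  by apply: eq_esum => t _; rewrite -EFinD subrK.
split=> //; move: kE; rewrite kv.
case: (esum _ _) => [r| |]//=; rewrite -EFinD => -[->].
by rewrite addrK.
Qed.

Lemma has_sumZ k v c : 0 <= c -> has_sum k v ->
  has_sum (fun t => c * k t) (c * v).
Proof.
move=> c0 kv; have k0 := kv.1.
have ck0 t : 0 <= c * k t by rewrite mulr_ge0.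
have [u ku uv] : exists2 u, has_sum (fun t => c * k t) u & u <= c * v.
  apply: has_sum_ex => // s; rewrite -big_distrr/= ler_wpM2l//.
  exact: has_sum_ge_fset.
suff: c * v <= u by move=> vu; have -> : c * v = u by apply/le_anti/andP.
have [->|cn0] := eqVneq c 0; first by rewrite mul0r (has_sum_ge0 ku).
have c_gt0 : 0 < c by rewrite lt_neqAle eq_sym cn0.
rewrite mulrC -ler_pdivlMr//; apply: (has_sum_le kv) => s.
by rewrite ler_pdivlMr// mulrC big_distrr/= (has_sum_ge_fset _ ku).
Qed.

Lemma has_sum_sum (I : finType) (c : I -> R) (k : I -> T -> R) (v : I -> R) :
  (forall i, 0 <= c i) -> (forall i, has_sum (k i) (v i)) ->
  has_sum (fun t => \sum_i c i * k i t) (\sum_i c i * v i).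
Proof.
move=> c0 kv; split=> [t|].
  by apply: sumr_ge0 => i _; rewrite mulr_ge0// (kv i).1.
under eq_esum do rewrite -sumEFin.
rewrite esum_sum => [|t i _ _]; last by rewrite lee_fin mulr_ge0// (kv i).1.
by rewrite -sumEFin; apply: eq_bigr => i _; rewrite (has_sumZ (c0 i) (kv i)).2.
Qed.

Lemma eq_has_sum k k' v : k =1 k' -> has_sum k v -> has_sum k' v.
Proof. by move=> /funext ->. Qed.

Lemma has_sum_dom k k' v' : (forall t, 0 <= k t <= k' t) -> has_sum k' v' ->
  exists2 v, has_sum k v & v <= v'.
Proof.
move=> kk' kv'; apply: has_sum_ex => [t|s]; first by case/andP: (kk' t).
apply: le_trans (has_sum_ge_fset s kv').
by apply: ler_sum => t _; case/andP: (kk' t).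
Qed.

Lemma le_has_sum k k' v v' :
  (forall t, k t <= k' t) -> has_sum k v -> has_sum k' v' -> v <= v'.
Proof.
by move=> kk' [_ kv] [_ kv']; rewrite -lee_fin -kv -kv' le_esum// => t _;
  rewrite lee_fin.
Qed.

Lemma fset_sum_mono k (s s' : {fset T}) : (forall t, 0 <= k t) ->
  (s `<=` s')%fset -> \sum_(t <- s) k t <= \sum_(t <- s') k t.
Proof.
move=> k0 ss'.
rewrite [leRHS](big_fsetID _ (mem s))/=.
have -> : [fset x in s' | x \in s]%fset = s.
  apply/fsetP => t; rewrite !inE/=.
  by apply: andb_idl => ts; exact: (fsubsetP ss').
by rewrite lerDl sumr_ge0.
Qed.

Lemma has_sum_approx k v eps : 0 < eps -> has_sum k v ->
  exists s0 : {fset T}, forall s, (s0 `<=` s)%fset ->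
    v - eps < \sum_(t <- s) k t.
Proof.
move=> e0 kv; apply: contrapT => /forallNP H.
suff: v <= v - eps by rewrite lerBrDr gerDl leNgt e0.
apply: (has_sum_le kv) => s0.
have /existsNP[s /not_implyP[s0s /negP]] := H s0.
by rewrite -leNgt; apply: le_trans; apply: fset_sum_mono => //; exact: kv.1.
Qed.

(** The set [s0] depends on [k] alone, so the tails of all families dominated by a multiple of [k]
    are small uniformly. This plays the part of dominated convergence when an exponent or a radius
    varies. *)
Lemma has_sum_tail k v eps : 0 < eps -> has_sum k v ->
  exists s0 : {fset T}, forall s, (s0 `<=` s)%fset -> forall B k' v',
    0 <= B -> (forall t, k' t <= B * k t) -> has_sum k' v' ->
    v' - B * eps <= \sum_(t <- s) k' t.
Proof.
move=> e0 kv; have [s0 Hs0] := has_sum_approx e0 kv.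
exists s0 => s s0s B k' v' B0 k'k k'v'; rewrite lerBlDr.
apply: (has_sum_le k'v') => s'.
apply: le_trans (fset_sum_mono k'v'.1 (fsubsetUr s s')) _.
rewrite (big_fsetID _ (mem s))/=.
have sE : [fset x in (s `|` s')%fset | x \in s]%fset = s.
  by apply/fsetP => t; rewrite !inE/= andb_idl// => ->.
rewrite sE lerD2l.
set c := [fset x in _ | x \notin _]%fset.
apply: le_trans (ler_sum _ (fun t _ => k'k t)) _.
rewrite -big_distrr/= ler_wpM2l//.
have := has_sum_ge_fset (s `|` s')%fset kv.
rewrite (big_fsetID _ (mem s))/= sE -/c.
have := Hs0 s s0s; lra.
Qed.

End HasSum.

(** * Walks *)

Section Walks.
Variables (R : realType) (V : finType) (E : countType).
Variables (G : ograph V E) (ell : E -> R).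
Implicit Types (p q : seq E) (e : E) (y z : V).

(** In contrast to [is_path], the empty sequence is a walk from each vertex to itself, so
    concatenation and induction need no separate case. *)
Fixpoint walk y p z : bool :=
  if p is e :: q then (ini G e == y) && walk (ter G e) q z else y == z.

Lemma walk_cat y p u q z : walk y p u -> walk y (p ++ q) z = walk u q z.
Proof.
elim: p y => [|e p IH] y /=; first by move=> /eqP ->.
by case/andP => -> /IH.
Qed.

Lemma path_length_cons e p :
  path_length ell (e :: p) = ell e + path_length ell p.
Proof. by rewrite /path_length big_cons. Qed.

Lemma path_length_nil : path_length ell [::] = 0.
Proof. by rewrite /path_length big_nil. Qed.

Lemma path_length_cat p q :
  path_length ell (p ++ q) = path_length ell p + path_length ell q.
Proof. by rewrite /path_length big_cat. Qed.

Lemma walk_last y p z : p != [::] ->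
  walk y p z = [&& is_path G p, path_starts G y p &
                   if p is e :: q then ter G (last e q) == z else false].
Proof.
case: p => // e p _ /=; rewrite [RHS]andbCA; congr (_ && _).
by elim: p e => [//|e' p IH] e /=; rewrite IH andbA [ter G e == _]eq_sym.
Qed.

Hypothesis ell_gt0 : forall e, 0 < ell e.

Lemma path_length_ge0 p : 0 <= path_length ell p.
Proof. by apply: sumr_ge0 => e _; exact: ltW. Qed.

Lemma path_length_gt0 p : p != [::] -> 0 < path_length ell p.
Proof.
case: p => // e p _; rewrite path_length_cons ltr_pwDl//.
exact: path_length_ge0.
Qed.

(* Otherwise every loop at [y] is a power of a shortest one. *)
Lemma noncommuting_loops y : (exists2 p, walk y p y & p != [::]) ->
  (forall d : R, 0 < d -> exists2 p, walk y p y &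
     forall n : nat, path_length ell p <> d * n%:R) ->
  exists p q, [/\ walk y p y, walk y q y & p ++ q <> q ++ p].
Proof.
move=> [p0 wp0 p0N] nonlat; apply: contrapT => comm.
have {}comm p q : walk y p y -> walk y q y -> p ++ q = q ++ p.
  by move=> wp wq; apply: contrapT => pq; apply: comm; exists p, q.
pose P n := `[< exists2 p, walk y p y & size p = n /\ p != [::] >].
have exP : exists n, P n by exists (size p0); apply/asboolP; exists p0.
case: (ex_minnP exP) => m /asboolP[c wc [sc cN]] mmin.
have [p wp pn] := nonlat _ (path_length_gt0 cN).
suff [k] : exists n : nat, path_length ell p = path_length ell c * n%:R.
  exact: pn.
move: {2}(size p) (leqnn (size p)) wp => n {pn}.
elim: n p => [|n IH] p.
  by rewrite leqn0 size_eq0 => /eqP-> _; exists 0%N; rewrite path_length_nil mulr0.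
have [->|pN] := eqVneq p [::].
  by move=> _ _; exists 0%N; rewrite path_length_nil mulr0.
move=> sp wp.
have lecp : (size c <= size p)%N by rewrite sc mmin//; apply/asboolP; exists p.
(* Since [p] and [c] commute and [p] is at least as long, [c] is a prefix of [p]; the remainder is a
   shorter loop at [y]. *)
have /(congr1 (take (size c))) := comm _ _ wp wc.
rewrite takel_cat// take_size_cat// => tp.
have pE : p = c ++ drop (size c) p by rewrite -{1}tp cat_take_drop.
have [||k kE] := IH (drop (size c) p).
- rewrite size_drop leq_subLR (leq_trans sp)// -addn1 addnC leq_add2r.
  by case: (c) cN.
- by move: wp; rewrite [in walk _ _ _]pE (walk_cat _ _ wc).
exists k.+1; rewrite [in LHS]pE path_length_cat kE -[k.+1]add1n natrD.
by rewrite mulrDr mulr1.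
Qed.

End Walks.

(** * Strong connectivity and non-lattice loop lengths at each vertex *)

Section Strong.
Variables (R : realType) (V : finType) (E : countType).
Variables (G : ograph V E) (ell : E -> R).
Implicit Types (p q : seq E) (e : E) (y z : V).
Hypothesis ell_gt0 : forall e, 0 < ell e.
Hypothesis G_connected : connected_ograph G.
Hypothesis H2 : forall e e' : E,
  exists2 q : seq E, is_path G (e :: q) & last e q = e'.
Hypothesis H3 : ~ exists2 d : R, 0 < d &
  forall c : seq E, is_closed_path G c ->
    exists n : nat, path_length ell c = d * n%:R.

Lemma closed_walk e p :
  is_closed_path G (e :: p) -> walk G (ini G e) (e :: p) (ini G e).
Proof. by case/andP => pc lc; rewrite walk_last// pc lc /= eqxx. Qed.

(** With no closed path the set of lengths would be empty, hence contained in any lattice, against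
    [H3]. *)
Lemma closed_path_ex : exists e p, walk G (ini G e) (e :: p) (ini G e).
Proof.
apply: contrapT => H; apply: H3; exists 1 => // -[//|e p] /closed_walk w.
by case: H; exists e, p.
Qed.

Lemma walk_edges e e' : exists p, walk G (ini G e) (rcons p e') (ter G e') /\
  (exists q, rcons p e' = e :: q).
Proof.
have [q pq lq] := H2 e e'; exists (belast e q).
rewrite -lq -lastI; split; last by exists q.
by rewrite walk_last// pq /= !eqxx.
Qed.

Lemma walk_rcons y p e : walk G y (rcons p e) (ter G e) -> walk G y p (ini G e).
Proof.
elim: p y => [|e' p IH] y /=; first by case/andP => /eqP ->.
by case/andP => -> /IH.
Qed.

(** An edge [e] is reversed by going from it to an edge [e0] of a closed path, along the rest of
    that closed path, then back to the origin of [e]. The closed path handles the case [e = e0],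
    where the paths from [H2] may be single edges. *)
Lemma adjacent_walk u v : Defs.adjacent G u v -> exists p, walk G u p v.
Proof.
have [e0 [p0 w0]] := closed_path_ex.
move=> /asboolP[e [[iu tv]|[iv tu]]].
  by exists [:: e]; rewrite /= iu tv !eqxx.
have [p [wp [q pE]]] := walk_edges e e0.
have [p' [/walk_rcons wp' _]] := walk_edges e0 e.
exists (q ++ (p0 ++ p')); rewrite -tu -iv.
move: wp; rewrite pE /= => /andP[_ wq]; rewrite (walk_cat _ _ wq).
by move: w0 => /= /andP[_ w0]; rewrite (walk_cat _ _ w0).
Qed.

Lemma strongly_connected y z : exists2 p, walk G y p z & p != [::].
Proof.
have reach u v : exists p, walk G u p v.
  have /connectP[s] := G_connected u v.
  elim: s u => [|w s IH] u /=; first by move=> _ ->; exists [::] => /=.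
  move=> /andP[/adjacent_walk[p wp] /IH{}IH] /IH[q wq].
  by exists (p ++ q); rewrite (walk_cat _ _ wp).
have [e0 [p0 w0]] := closed_path_ex.
have [p wp] := reach y (ini G e0); have [q wq] := reach (ini G e0) z.
(* The closed path keeps the walk nonempty even when [y = z]. *)
exists (p ++ ((e0 :: p0) ++ q)); last by case: (p).
by rewrite (walk_cat _ _ wp) (walk_cat _ _ w0).
Qed.

(** If [p] leads from [y] to a closed path [c] and [q] leads back, the length of [c] is the
    difference between those of the loops [p c q] and [p q]. A lattice holding all loop lengths at
    [y] would thus hold all closed lengths. *)
Lemma loops_nonlattice y (d : R) : 0 < d -> exists2 p, walk G y p y &
  forall n : nat, path_length ell p <> d * n%:R.
Proof.
move=> d0; apply: contrapT => H.
have {}H p : walk G y p y -> exists n : nat, path_length ell p = d * n%:R.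
  by move=> wp; apply: contrapT => /forallNP pn; apply: H; exists p.
apply: H3; exists d => // -[//|e c] /closed_walk wc.
have [p wp _] := strongly_connected y (ini G e).
have [q wq _] := strongly_connected (ini G e) y.
have [m mE] : exists m : nat, path_length ell (p ++ q) = d * m%:R.
  by apply: H; rewrite (walk_cat _ _ wp).
have [n nE] : exists n : nat, path_length ell (p ++ ((e :: c) ++ q)) = d * n%:R.
  by apply: H; rewrite (walk_cat _ _ wp) (walk_cat _ _ wc).
rewrite !path_length_cat in mE nE.
have mn : (m <= n)%N.
  rewrite -(@ler_nat R) -(ler_pM2l d0) -mE -nE.
  by rewrite lerD2l lerDr (path_length_ge0 ell_gt0).
exists (n - m)%N; rewrite natrB// mulrBr -mE -nE; ring.
Qed.

End Strong.

(** * The exponent *)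

Section Exponent.
Variables (R : realType) (V : finType) (E : countType).
Variables (G : ograph V E) (ell : E -> R).
Implicit Types (p q : seq E) (e : E) (y z : V) (s : R) (w : V -> R).
Hypothesis V_nonempty : (0 < #|V|)%N.
Hypothesis ell_gt0 : forall e, 0 < ell e.
Hypothesis H1 : forall s : R, 0 < s ->
  (\esum_(e in [set: E]) (expR (- s * ell e))%:E < +oo)%E.
Hypothesis strong : forall y z, exists2 p, walk G y p z & p != [::].
Hypothesis nonlattice : forall y (d : R), 0 < d ->
  exists2 p, walk G y p y & forall n : nat, path_length ell p <> d * n%:R.

Lemma sum_indicator (y : V) (M : V -> R) : \sum_z (y == z)%:R * M z = M y.
Proof.
rewrite (bigD1 y)//= eqxx mul1r big1 ?addr0// => z zy.
by rewrite eq_sym (negbTE zy) mul0r.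
Qed.

Lemma has_sum_expR s : 0 < s -> exists v, has_sum (fun e => expR (- s * ell e)) v.
Proof. by move=> s0; apply: fin_has_sum (H1 s0) => t; exact: expR_ge0. Qed.

(** Outside a finite set of edges the tail of the series with exponent 1 is below [expR (- 1)],
    which forces length above 1; a finite minimum handles the rest. *)
Lemma ell_bounded_below : exists2 l0 : R, 0 < l0 & forall e, l0 <= ell e.
Proof.
have [v kv] := has_sum_expR (@ltr01 R).
have [s0 Hs0] := has_sum_approx (expR_gt0 (- 1)) kv.
have [m m0 Hm] : exists2 m : R, 0 < m & forall e, e \in enum_fset s0 -> m <= ell e.
  elim: (enum_fset s0) => [|e s [m m0 IH]]; first by exists 1.
  exists (Num.min m (ell e)); first by rewrite lt_min m0 ell_gt0.
  by move=> e'; rewrite inE ge_min => /predU1P[->|/IH->//]; rewrite lexx orbT.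
exists (Num.min m 1); first by rewrite lt_min m0 ltr01.
move=> e; rewrite ge_min; have [/Hm->//|es] := boolP (e \in s0).
apply/orP; right.
have := has_sum_ge_fset (e |` s0)%fset kv.
rewrite big_fsetU1//= => le1.
have lt1 := Hs0 s0 (fsubset_refl _).
have : expR (- 1 * ell e) < expR (- 1) by lra.
by rewrite ltr_expR mulN1r ltrN2 => /ltW.
Qed.

(** As [l0 <= ell e], raising the exponent from [1] to [1 + t] shrinks the sum [v] at least by the
    factor [expR (- (t * l0))]. The choice of [t] suffices because [1 + t * l0 <= expR (t * l0)]. *)
Lemma expR_sum_small (eta : R) : 0 < eta ->
  exists2 s : R, 0 < s &
    exists2 v, has_sum (fun e => expR (- s * ell e)) v & v <= eta.
Proof.
move=> eta0; have [v kv] := has_sum_expR (@ltr01 R).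
have [l0 l00 ll] := ell_bounded_below.
have v0 := has_sum_ge0 kv.
pose t := v / (eta * l0).
have t0 : 0 <= t by rewrite divr_ge0// ltW// mulr_gt0.
exists (1 + t); first by rewrite ltr_wpDr.
have [|u ku uv] := @has_sum_dom _ _ (fun e => expR (- (1 + t) * ell e)) _ _ _
  (has_sumZ (expR_ge0 (- (t * l0))) kv).
  move=> e; rewrite expR_ge0 -expRD ler_expR.
  have : t * l0 <= t * ell e by rewrite ler_wpM2l.
  lra.
exists u => //; apply: le_trans uv _.
rewrite expRN mulrC ler_pdivrMr ?expR_gt0//.
apply: le_trans (_ : eta * (1 + t * l0) <= _); last first.
  by rewrite ler_wpM2l ?expR_ge1Dx// ltW.
have -> : eta * (1 + t * l0) = eta + v.
  by rewrite /t; field; rewrite !gt_eqF.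
by rewrite lerDr ltW.
Qed.

(** The terms of [(w A_s)_z], where [A_s] is the edge-weight matrix with exponent [s]. The indicator
    keeps all of [E] as index set, so families for different [z] can be added. *)
Definition inflow s w z e := (ter G e == z)%:R * (w (ini G e) * expR (- s * ell e)).

Definition strict_at s w z := exists2 v, has_sum (inflow s w z) v & v < w z.
Definition weak_at s w z := exists2 v, has_sum (inflow s w z) v & v <= w z.

Lemma inflow_ge0 s w z e : (forall y, 0 <= w y) -> 0 <= inflow s w z e.
Proof. by move=> w0; rewrite mulr_ge0// mulr_ge0// expR_ge0. Qed.

Lemma strictW s w z : strict_at s w z -> weak_at s w z.
Proof. by case=> v kv /ltW vw; exists v. Qed.

Lemma weak_atP s w z : (forall y, 0 <= w y) ->
  (forall S : {fset E}, \sum_(e <- S) inflow s w z e <= w z) -> weak_at s w z.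
Proof. by move=> w0; apply: has_sum_ex => e; exact: inflow_ge0. Qed.

Lemma weak_edge s w e : weak_at s w (ter G e) ->
  w (ini G e) * expR (- s * ell e) <= w (ter G e).
Proof.
case=> v kv; apply: le_trans; have := has_sum_ge_term e kv.
by rewrite /inflow eqxx mul1r.
Qed.

Lemma weak_walk s w y p z : (forall u, weak_at s w u) -> walk G y p z ->
  w y * expR (- s * path_length ell p) <= w z.
Proof.
move=> ww; elim: p y => [|e p IH] y /=.
  by move=> /eqP ->; rewrite path_length_nil mulr0 expR0 mulr1.
case/andP => /eqP <- /IH; apply: le_trans.
rewrite path_length_cons mulrDr expRD mulrA ler_wpM2r ?expR_ge0//.
exact: weak_edge.
Qed.

(* Distinct walks with the same number of edges carry disjoint weights. *)
Lemma weak_walk2 s w y y' p q z : (forall u, weak_at s w u) ->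
  size p = size q -> p <> q -> walk G y p z -> walk G y' q z ->
  w y * expR (- s * path_length ell p) +
  w y' * expR (- s * path_length ell q) <= w z.
Proof.
move=> ww; elim: p y q y' => [|e p IH] y [|e' q] y'//= [spq] pq.
case/andP => /eqP <- wp /andP[/eqP <- wq].
rewrite !path_length_cons !mulrDr !expRD !mulrA.
have [pEq|pNq] := pselect (p = q); last first.
  by apply: le_trans (IH _ _ _ spq pNq wp wq); apply: lerD;
    rewrite ler_wpM2r ?expR_ge0// weak_edge.
(* The tails agree, so the first edges differ and enter the same vertex: both are terms of one
   inflow. *)
have ee' : e != e' by apply/eqP => ee'; apply: pq; rewrite ee' pEq.
have tee' : ter G e = ter G e'.
  rewrite -pEq in wq; elim: (p) (ter G e) (ter G e') wp wq => [|e1 p1 _] u u' /=.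
    by move=> /eqP -> /eqP.
  by move=> /andP[/eqP <- _] /andP[/eqP].
rewrite -pEq -mulrDl; apply: le_trans (weak_walk ww wp).
rewrite ler_wpM2r ?expR_ge0//.
have [v kv] := ww (ter G e); apply: le_trans.
have := has_sum_ge_fset [fset e; e']%fset kv.
by rewrite big_fsetU1 ?inE//= big_seq_fset1 /inflow tee' !eqxx !mul1r.
Qed.

Definition admissible s := 0 < s /\ exists w, forall z, 0 < w z /\ strict_at s w z.

Lemma admissible_ex : exists s, admissible s.
Proof.
have [//|s s0 [v kv v1]] := @expR_sum_small (2^-1).
exists s; split => //; exists (fun=> 1) => z; split=> //.
have [e|u ku uv] := @has_sum_dom _ _ (inflow s (fun=> 1) z) _ _ _ kv.
  rewrite inflow_ge0//= /inflow mul1r ler_piMl ?expR_ge0//.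
  by case: eqP.
exists u => //; lra.
Qed.

(** For non-commuting loops [p] and [q], the walks [p ++ q] and [q ++ p] have the same number of
    edges and the same length [L]. Subinvariance gives [2 * expR (- s * L) <= 1], and
    [1 - s * L <= expR (- s * L)] then bounds [s] below. *)
Lemma admissible_lbound : exists2 c : R, 0 < c & forall s, admissible s -> c <= s.
Proof.
have /card_gt0P[y _] := V_nonempty.
have [p [q [wp wq pq]]] := noncommuting_loops ell_gt0 (strong y y) (@nonlattice y).
pose L := path_length ell (p ++ q).
have L0 : 0 < L.
  by apply: path_length_gt0 => //; case: (p) pq => //=; rewrite cats0.
have LE : path_length ell (q ++ p) = L by rewrite /L !path_length_cat addrC.
exists (2 * L)^-1; first by rewrite invr_gt0 mulr_gt0.
move=> s [s0 [w ws]]; have w0 := (ws y).1.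
have := @weak_walk2 s w y y (p ++ q) (q ++ p) y (fun u => strictW (ws u).2) _ pq.
rewrite !size_cat addnC (walk_cat _ _ wp) (walk_cat _ _ wq) => /(_ erefl wq wp).
rewrite LE -/L -mulrDr -[leRHS]mulr1 ler_pM2l// => le1.
have := expR_ge1Dx (- s * L) => ge1.
rewrite invfM ler_pdivrMr//; lra.
Qed.

(* The tail of the series is uniformly small on [s/2, s]; on the remaining
   finitely many edges the weights are continuous. *)
Lemma admissible_left s : admissible s -> exists2 s', s' < s & admissible s'.
Proof.
move=> [s0 [w ws]].
have h0 : 0 < s / 2 by rewrite divr_gt0.
have [v kv] := has_sum_expR h0.
pose W := \sum_z w z.
have w0 z : 0 <= w z by rewrite ltW// (ws z).1.
have wW z : w z <= W by rewrite /W (bigD1 z)//= lerDl sumr_ge0.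
have W0 : 0 <= W by apply: sumr_ge0.
have near_ok : \forall s' \near s, forall z, s / 2 < s' -> strict_at s' w z.
  suff near_z z : \forall s' \near s, s / 2 < s' -> strict_at s' w z.
    exact: (@filter_forall _ _ _ _ (nbhs_filter s) near_z).
  have [_ [u ku uw]] := ws z.
  (* The tail beyond [S0] costs at most [W * eps], half of the slack; the change on [S0] is allowed
     the other half. *)
  pose eps := (w z - u) / (2 * (W + 1)).
  have eps0 : 0 < eps by rewrite divr_gt0 ?subr_gt0// mulr_gt0// ltr_wpDl.
  have [S0 HS0] := has_sum_tail eps0 kv.
  have uS := has_sum_ge_fset S0 ku.
  have : (\sum_(e <- S0) inflow s' w z e) @[s' --> s] -->
     \sum_(e <- S0) inflow s w z e.
    apply: cvg_big => [|e _]; first exact: (@add_continuous R^o).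
    apply: cvgMr; apply: cvgMr; apply: continuous_cvg; first exact: continuous_expR.
    by apply: cvgMl; apply: cvgN; exact: cvg_id.
  move=> cv.
  have lt_u : \sum_(e <- S0) inflow s w z e < u + (w z - u) / 2.
    by apply: le_lt_trans uS _; rewrite ltrDl divr_gt0// subr_gt0.
  have nb := @cvgr_lt _ _ _ (nbhs_filter s) _ _ cv _ lt_u.
  apply: filterS nb => s' lt_s' s's.
  have dom e : 0 <= inflow s' w z e <= W * expR (- (s / 2) * ell e).
    rewrite inflow_ge0//=; apply: le_trans (_ : w (ini G e) * expR (- s' * ell e) <= _).
      rewrite /inflow ler_piMl//; first by rewrite mulr_ge0 ?expR_ge0.
      by case: eqP.
    by rewrite ler_pM ?expR_ge0// ler_expR !mulNr lerN2 ler_wpM2r ?(ltW s's)// ltW.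
  have [u' ku' _] := has_sum_dom dom (has_sumZ W0 kv).
  exists u' => //.
  have := HS0 S0 (fsubset_refl _) W _ u' W0 (fun e => (andP (dom e)).2) ku'.
  have : W * eps <= (w z - u) / 2.
    rewrite /eps mulrA ler_pdivrMr ?mulr_gt0 ?ltr_wpDl//.
    have -> : (w z - u) / 2 * (2 * (W + 1)) = (w z - u) * (W + 1) by field.
    by rewrite mulrC ler_pM2l ?subr_gt0// lerDl.
  move: lt_s'; lra.
have [d /= d0 Hd] := near_ok.
(* [d / 2] stays within the neighbourhood just found, and [s / 4] keeps the new exponent above
   [s / 2]. *)
exists (s - Num.min (d / 2) (s / 4)).
  by rewrite gtrDl oppr_lt0 lt_min !divr_gt0.
have m1 : Num.min (d / 2) (s / 4) <= d / 2 by rewrite ge_min lexx.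
have m2 : Num.min (d / 2) (s / 4) <= s / 4 by rewrite ge_min lexx orbT.
have m0 : 0 < Num.min (d / 2) (s / 4) by rewrite lt_min !divr_gt0.
split; first lra.
exists w => z; split; first exact: (ws z).1.
apply: Hd => /=; last by lra.
rewrite opprB addrC subrK ger0_norm ?ltW//; lra.
Qed.

End Exponent.

(** Compactness of the unit interval gives a cluster point, and an ultrafilter converges to its
    cluster points. One ultrafilter serves all coordinates at once, without successive extraction of
    subsequences. *)
Lemma ultrafilter_cvg01 (R : realType) (T : Type) (U : set_system T)
    (f : T -> R) : UltraFilter U -> (\forall t \near U, 0 <= f t <= 1) ->
  exists2 l : R, 0 <= l & f @ U --> l.
Proof.
move=> UU f01; have PU : ProperFilter U by exact: ultra_proper.
have PfU : ProperFilter (f @ U) := fmap_proper_filter f PU.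
have [|l [l01 cl]] := @segment_compact R 0 1 (f @ U) PfU.
  by apply: filterS f01 => t ft; rewrite /= in_itv.
exists l; first by move: l01; rewrite /= in_itv /= => /andP[].
move=> B Bl; have [//|UB] := in_ultra_setVsetC (f @^-1` B) UU.
by have [x [/= nBx Bx]] := cl (~` B) B UB Bl.
Qed.

(** * Positive left eigenvector at the critical exponent *)

Section Perron.
Variables (R : realType) (V : finType) (E : countType).
Variables (G : ograph V E) (ell : E -> R).
Implicit Types (p q : seq E) (e : E) (y z : V) (s : R) (w : V -> R).
Hypothesis V_nonempty : (0 < #|V|)%N.
Hypothesis ell_gt0 : forall e, 0 < ell e.
Hypothesis H1 : forall s : R, 0 < s ->
  (\esum_(e in [set: E]) (expR (- s * ell e))%:E < +oo)%E.
Hypothesis strong : forall y z, exists2 p, walk G y p z & p != [::].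
Hypothesis nonlattice : forall y (d : R), 0 < d ->
  exists2 p, walk G y p y & forall n : nat, path_length ell p <> d * n%:R.

Lemma walk_exit (P : V -> Prop) y p z : walk G y p z -> P y -> ~ P z ->
  exists e, P (ini G e) /\ ~ P (ter G e).
Proof.
elim: p y => [|e p IH] y /=; first by move=> /eqP ->.
move=> /andP[/eqP <- wp] Pe Pz.
have [Pt|Pt] := pselect (P (ter G e)); last by exists e.
exact: IH wp Pt Pz.
Qed.

Lemma inflow_mono s w w' z e : (forall y, w' y <= w y) ->
  inflow G ell s w' z e <= inflow G ell s w z e.
Proof. by move=> ww'; rewrite ler_wpM2l// ler_wpM2r ?expR_ge0. Qed.

(* Lowering [w] slightly at the source of an edge from a strict vertex to a
   non-strict one keeps every strict inequality and creates a new one. *)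
Lemma strict_spread s w :
  (forall z, 0 < w z /\ weak_at G ell s w z) ->
  (exists z, strict_at G ell s w z) ->
  exists w', forall z, 0 < w' z /\ strict_at G ell s w' z.
Proof.
pose N w := #|[pred z | ~~ `[< strict_at G ell s w z >]]|.
move: {2}(N w) (leqnn (N w)) => n; elim: n w => [|n IH] w Nw ww [z0 st0].
  exists w => z; split; first exact: (ww z).1.
  apply: contrapT => nz; move: Nw; rewrite leqn0 => /eqP/card0_eq/(_ z).
  by rewrite !inE => /negbFE/asboolP.
have [[z1 nz1]|] := pselect (exists z, ~ strict_at G ell s w z); last first.
  move=> /forallNP H; exists w => z; split; first exact: (ww z).1.
  by apply: contrapT => /H.
have [p wp _] := strong z0 z1.
have [e [ste nste]] := walk_exit wp st0 nz1.
set y := ini G e in ste; set z := ter G e in nste.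
have zy : z != y by apply/eqP => zy; apply: nste; rewrite zy.
have [vy ky vyw] := ste.
(* Half the smaller of [w y] and its slack: the lowered value stays positive and above the old
   inflow at [y]. *)
pose eta := Num.min (w y) (w y - vy) / 2.
have wy0 : 0 < w y := (ww y).1.
have m0 : 0 < Num.min (w y) (w y - vy) by rewrite lt_min wy0 subr_gt0.
have m1 : Num.min (w y) (w y - vy) <= w y by rewrite ge_min lexx.
have m2 : Num.min (w y) (w y - vy) <= w y - vy by rewrite ge_min lexx orbT.
have eta0 : 0 < eta by rewrite divr_gt0.
have eta1 : eta < w y by rewrite /eta; lra.
have eta2 : vy < w y - eta by rewrite /eta; lra.
pose w' u := if u == y then w y - eta else w u.
have w'w u : w' u <= w u.
  by rewrite /w'; case: eqP => [->|//]; rewrite gerBl ltW.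
have w'0 u : 0 < w' u.
  by rewrite /w'; case: eqP => _; [rewrite subr_gt0|exact: (ww u).1].
have w'0' u : 0 <= w' u by exact: ltW.
have dom u e' : 0 <= inflow G ell s w' u e' <= inflow G ell s w u e'.
  by rewrite inflow_ge0//= inflow_mono.
have sty : strict_at G ell s w' y.
  have [v' kv' v'v] := has_sum_dom (dom y) ky.
  by exists v' => //; rewrite /w' eqxx (le_lt_trans v'v).
have stw u : strict_at G ell s w u -> strict_at G ell s w' u.
  have [->//|uy [v kv vw]] := eqVneq u y.
  have [v' kv' v'v] := has_sum_dom (dom u) kv.
  by exists v' => //; rewrite /w' (negbTE uy) (le_lt_trans v'v).
have stz : strict_at G ell s w' z.
  have [v kv vw] := (ww z).2.
  have [v' kv' v'v] := has_sum_dom (dom z) kv.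
  exists v' => //; rewrite /w' (negbTE zy) -/(w' _) (lt_le_trans _ vw)//.
  have := has_sum_ge_term e (has_sumB kv kv' (fun t => (andP (dom z t)).2)).
  rewrite -subr_gt0; apply: lt_le_trans.
  rewrite /inflow eqxx !mul1r -mulrBl mulr_gt0 ?expR_gt0// subr_gt0.
  by rewrite /w' eqxx gtrBl.
apply: (IH w'); last by exists y.
- rewrite -ltnS; apply: leq_trans Nw; apply: proper_card.
  apply/properP; split.
    apply/fintype.subsetP => u; rewrite !inE; apply: contraNN => /asboolP su.
    by apply/asboolP; exact: stw.
  exists z; rewrite !inE; first exact/asboolPn.
  by rewrite negbK; apply/asboolP.
- move=> u; split => //; have [->|uy] := eqVneq u y; first exact: strictW.
  have [v kv vw] := (ww u).2.
  have [v' kv' v'v] := has_sum_dom (dom u) kv.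
  by exists v' => //; rewrite /w' (negbTE uy) (le_trans v'v).
Qed.

Let A : set R := [set s | admissible G ell s].

(** Normalized subinvariant vectors for admissible exponents tending to the infimum [h] converge
    along an ultrafilter to a weakly subinvariant vector. Were some inequality strict, strictness
    would spread to all vertices and [h] would be admissible. *)
Lemma perron : exists h w, 0 < h /\
  forall z, 0 < w z /\ has_sum (inflow G ell h w z) (w z).
Proof.
have [c c0 Ac] := admissible_lbound V_nonempty ell_gt0 strong nonlattice.
have A0 : A !=set0 by have [s As] := admissible_ex G ell_gt0 H1; exists s.
have hA : has_inf A by split => //; exists c => s; exact: Ac.
pose h := inf A.
have h0 : 0 < h.
  by apply: (lt_le_trans c0); apply: lb_le_inf => // s; exact: Ac.
(* The infimum is not attained, since every admissible exponent has a smaller one. *)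
have nAh : ~ A h.
  move=> /(admissible_left ell_gt0 H1)[s' s'h As'].
  by have := ge_inf hA.2 As'; rewrite leNgt s'h.
have clA : closure A h.
  move=> B /nbhs_ballP[eps /= eps0 hB].
  have [s As sh] := inf_adherent eps0 hA.
  exists s; split => //; apply: hB.
  have hs : h <= s := ge_inf hA.2 As.
  rewrite /ball /= distrC ger0_norm ?subr_ge0//; rewrite -/h in sh; lra.
have PF : ProperFilter (within A (nbhs h)) := within_nbhs_proper clA.
have [U [UU sU]] := @ultraFilterLemma R _ PF.
have PU : ProperFilter U by exact: ultra_proper.
have UA : \forall s \near U, A s by apply: sU; exact: withinT.
have cvh : (fun s : R => s) @ U --> h.
  by move=> B Bh; apply: sU; exact: cvg_within Bh.
have /choice[W HW] : forall s, exists w, A s ->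
    [/\ forall z, 0 <= w z, \sum_z w z = 1 & forall z, weak_at G ell s w z].
  move=> s; have [As|nAs] := pselect (A s); last by exists (fun=> 0).
  have [_ [w ws]] := As.
  pose T := \sum_z w z.
  have T0 : 0 < T.
    have /card_gt0P[y _] := V_nonempty.
    by rewrite /T (bigD1 y)//= ltr_pwDl ?(ws y).1// sumr_ge0// => z _; rewrite ltW// (ws z).1.
  exists (fun z => T^-1 * w z) => _; split.
  - by move=> z; apply: mulr_ge0; rewrite ?invr_ge0 ltW// (ws z).1.
  - by rewrite -big_distrr/= mulVf ?gt_eqF.
  - move=> z; have [v kv vw] := strictW (ws z).2.
    have Ti0 : 0 <= T^-1 by rewrite invr_ge0 ltW.
    exists (T^-1 * v); last by rewrite ler_wpM2l.
    by apply: eq_has_sum (has_sumZ Ti0 kv) => e; rewrite /inflow; ring.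
have /choice[l Hl] : forall z, exists l : R, 0 <= l /\ (fun s => W s z) @ U --> l.
  move=> z; have [|l l0 cvl] := @ultrafilter_cvg01 R R U (fun s => W s z) UU.
    apply: filterS UA => s /HW[w0 w1 _]; rewrite w0 -w1 (bigD1 z)//= lerDl.
    exact: sumr_ge0.
  by exists l.
have l0 z : 0 <= l z := (Hl z).1.
have suml : 1 <= \sum_z l z.
  have cvS : (fun s => \sum_z W s z) @ U --> \sum_z l z.
    by apply: cvg_big => [|z _]; [exact: (@add_continuous R^o)|exact: (Hl z).2].
  apply: (cvgr_to_ge cvS).
  by apply: filterS UA => s /HW[_ -> _].
(* Passing to the limit in each finite partial sum is enough, the full sum being their supremum;
   strictness may be lost. *)
have wl z : weak_at G ell h l z.
  apply: weak_atP => // S.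
  suff cvS : (fun s => \sum_(e <- S) inflow G ell s (W s) z e) @ U -->
      \sum_(e <- S) inflow G ell h l z e.
    apply: (ler_cvg_to cvS (Hl z).2).
    apply: filterS UA => s /HW[_ _ /(_ z)[v kv]]; apply: le_trans.
    exact: has_sum_ge_fset.
  apply: cvg_big => [|e _]; first exact: (@add_continuous R^o).
  apply: cvgMr; apply: cvgM; first exact: (Hl _).2.
  apply: continuous_cvg; first exact: continuous_expR.
  by apply: cvgMl; apply: cvgN.
have [y ly] : exists y, 0 < l y.
  apply: contrapT => /forallNP H; suff: \sum_z l z <= 0 by lra.
  by apply: sumr_le0 => z _; rewrite leNgt; apply/negP; exact: H.
have lpos z : 0 < l z.
  have [p wp _] := strong y z.
  by apply: lt_le_trans (weak_walk wl wp); rewrite mulr_gt0 ?expR_gt0.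
exists h, l; split => // z; split => //.
have [v kv] := wl z; rewrite le_eqVlt => /orP[/eqP <-//|vl].
exfalso; apply: nAh; split => //; apply: (@strict_spread h l) => [u|]; first by [].
by exists z, v.
Qed.

End Perron.

(** * Counting functions *)

Section Counting.
Variables (R : realType) (V : finType) (E : countType).
Variables (G : ograph V E) (ell : E -> R).
Implicit Types (p q : seq E) (e : E) (y z : V) (r s : R) (k : seq E -> R).
Hypothesis ell_gt0 : forall e, 0 < ell e.
Hypothesis H1 : forall s : R, 0 < s ->
  (\esum_(e in [set: E]) (expR (- s * ell e))%:E < +oo)%E.
Variable h : R.
Hypothesis h_gt0 : 0 < h.

Local Notation len := (path_length ell).

Fixpoint walk_from y p : bool :=
  if p is e :: q then (ini G e == y) && walk_from (ter G e) q else true.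

(** A walk is either empty or a first edge followed by a walk from its end. The renewal equations
    for [count] and [primitive] both come from this decomposition. *)
Lemma esum_walk_step y k : (forall p, 0 <= k p) ->
  (\esum_(p in [set: seq E]) ((walk_from y p)%:R * k p)%:E =
   (k [::])%:E + \esum_(e in [set: E]) \esum_(p in [set: seq E])
     ((ini G e == y)%:R * ((walk_from (ter G e) p)%:R * k (e :: p)))%:E)%E.
Proof.
move=> k0.
rewrite (esumID [set [::]]) ?setTI; last first.
  by move=> p _; rewrite lee_fin mulr_ge0.
rewrite esum_set1 /= mul1r ?lee_fin//; congr (_ + _)%E.
rewrite esum_esum; last by move=> e p _ _; rewrite lee_fin !mulr_ge0.
rewrite (reindex_esum ([set: E] `*`` (fun=> [set: seq E])) _
  (fun c : E * seq E => c.1 :: c.2)).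
  by apply: eq_esum => -[e p] _ /=; rewrite mulrA -natrM mulnb.
split.
- by move=> [e p] _.
- by move=> [e p] [e' p'] _ _ /= [-> ->].
- by move=> [|e p] //= _; exists (e, p).
Qed.

Lemma has_sum_walk_step y k v (K : E -> R) : (forall p, 0 <= k p) ->
  (forall e, has_sum (fun p => (walk_from (ter G e) p)%:R * k (e :: p)) (K e)) ->
  has_sum (fun p => (walk_from y p)%:R * k p) v ->
  has_sum (fun e => (ini G e == y)%:R * K e) (v - k [::]).
Proof.
move=> k0 HK [_]; rewrite esum_walk_step// => kv; split.
  by move=> e; rewrite mulr_ge0// (has_sum_ge0 (HK e)).
move: kv; under eq_esum do rewrite (has_sumZ (ler0n _ _) (HK _)).2.
case: (esum _ _) => [x| |]//=; rewrite -EFinD => -[<-].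
by rewrite addrAC subrr add0r.
Qed.

Definition count_term y r p : R := (walk_from y p)%:R * (len p <= r)%R%:R.

Lemma count_term_ge0 y r p : 0 <= count_term y r p.
Proof. by rewrite mulr_ge0. Qed.

Lemma count_term_cons e r p :
  (walk_from (ter G e) p)%:R * (len (e :: p) <= r)%R%:R =
  count_term (ter G e) (r - ell e) p.
Proof. by rewrite /count_term path_length_cons lerBrDl. Qed.

(** Each edge uses up at least [l0], so induction on [n] with [r < n * l0] reaches negative radii,
    where no walk counts. As the weights with exponent [s] sum to at most [1 / 2], the bound
    reproduces itself: [expR (s * r)] covers the empty walk and the edges contribute at most as much
    again. *)
Lemma count_finite : exists s : R, forall y r,
  exists2 v, has_sum (count_term y r) v & v <= 2 * expR (s * r).
Proof.
have [l0 l00 ll] := ell_bounded_below ell_gt0 H1.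
have [//|s s0 [u ku u2]] := @expR_sum_small R E ell ell_gt0 H1 (2^-1).
exists s => y r.
have [n rn] : exists n : nat, r < n%:R * l0.
  by exists (Num.truncn (r / l0)).+1; rewrite -ltr_pdivrMr// truncnS_gt.
elim: n y r rn => [|n IH] y r rn.
  rewrite mul0r in rn; exists 0; last by rewrite mulr_ge0 ?expR_ge0.
  split=> [p|]; first exact: count_term_ge0.
  rewrite esum1// => p _; rewrite /count_term leNgt (lt_le_trans rn) ?mulr0//.
  exact: path_length_ge0.
have /choice[K HK] : forall e, exists K : R,
    has_sum (count_term (ter G e) (r - ell e)) K /\
    K <= 2 * expR (s * (r - ell e)).
  move=> e; have [|v] := IH (ter G e) (r - ell e); last by exists v.
  have := ll e; move: rn; rewrite -[n.+1]addn1 natrD mulrDl mul1r; lra.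
have K0 e : 0 <= K e := has_sum_ge0 (HK e).1.
pose kr p : R := (len p <= r)%R%:R.
have bound : (\esum_(p in [set: seq E]) (count_term y r p)%:E <=
              (2 * expR (s * r))%:E)%E.
  rewrite (@esum_walk_step y kr)// /kr path_length_nil.
  have [|v kv vle] := @has_sum_dom _ _ (fun e => (ini G e == y)%:R * K e) _ _ _
    (has_sumZ (ler0n _ 2) (has_sumZ (expR_ge0 (s * r)) ku)).
    move=> e; rewrite mulr_ge0//=; apply: le_trans (_ : K e <= _).
      by rewrite ler_piMl//; case: eqP.
    rewrite (le_trans (HK e).2)// -expRD mulrBr mulNr lexx//.
  rewrite (_ : esum _ _ = v%:E); last first.
    rewrite -kv.2; apply: eq_esum => e _.
    under eq_esum do rewrite count_term_cons.
    by rewrite (has_sumZ (ler0n _ _) (HK e).1).2.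
  rewrite -EFinD lee_fin.
  have : (0 <= r)%R%:R <= expR (s * r).
    case: (lerP 0 r) => r0 /=; last exact: expR_ge0.
    by apply: le_trans (expR_ge1Dx _); rewrite lerDl mulr_ge0// ltW.
  have : expR (s * r) * u <= expR (s * r) * 2^-1 by rewrite ler_wpM2l ?expR_ge0.
  lra.
have [|v kv] := @fin_has_sum _ _ (count_term y r) (count_term_ge0 y r).
  exact: le_lt_trans bound (ltry _).
by exists v => //; rewrite -lee_fin -kv.2.
Qed.

Definition count y r : R :=
  fine (\esum_(p in [set: seq E]) (count_term y r p)%:E).

Lemma has_sum_count y r : has_sum (count_term y r) (count y r).
Proof.
by have [s /(_ y r)[v kv _]] := count_finite; rewrite /count kv.2.
Qed.

Lemma count_ge0 y r : 0 <= count y r.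
Proof. exact: has_sum_ge0 (has_sum_count y r). Qed.

Lemma count_mono y r r' : r <= r' -> count y r <= count y r'.
Proof.
move=> rr'; apply: le_has_sum (has_sum_count _ _) (has_sum_count _ _) => p.
rewrite ler_wpM2l// ler_nat; case: (lerP (len p) r) => //= pr.
by rewrite (le_trans pr rr').
Qed.

Lemma count_step y r :
  has_sum (fun e => (ini G e == y)%:R * count (ter G e) (r - ell e))
    (count y r - (0 <= r)%R%:R).
Proof.
have := @has_sum_walk_step y (fun p => (len p <= r)%R%:R) (count y r)
  (fun e => count (ter G e) (r - ell e)).
rewrite path_length_nil; apply => //; last exact: has_sum_count.
move=> e; apply: eq_has_sum (has_sum_count _ _) => p.
by rewrite count_term_cons.
Qed.

(* [primitive y R] is h times the integral of [e^(-ht) count y t] on [0, R],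
   summed walk by walk. *)
Definition prim_fun r p : R := Num.max 0 (expR (- h * len p) - expR (- h * r)).
Definition prim_term y r p : R := (walk_from y p)%:R * prim_fun r p.
Definition primitive y r : R :=
  fine (\esum_(p in [set: seq E]) (prim_term y r p)%:E).

Lemma prim_fun_ge0 r p : 0 <= prim_fun r p.
Proof. by rewrite le_max lexx. Qed.

Lemma has_sum_primitive y r : has_sum (prim_term y r) (primitive y r).
Proof.
have [p|v kv _] := @has_sum_dom _ _ (prim_term y r) _ _ _ (has_sum_count y r).
  rewrite mulr_ge0 ?prim_fun_ge0//= ler_wpM2l// /prim_fun ge_max ler0n/=.
  case: (lerP (len p) r) => pr /=.
    have e1 : expR (- h * len p) <= 1.
      by rewrite -expR0 ler_expR mulNr oppr_le0 mulr_ge0 ?(ltW h_gt0)// path_length_ge0.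
    by have := expR_ge0 (- h * r); lra.
  by rewrite subr_le0 ler_expR !mulNr lerN2 ler_pM2l// ltW.
by rewrite /primitive kv.2.
Qed.

Lemma primitive_ge0 y r : 0 <= primitive y r.
Proof. exact: has_sum_ge0 (has_sum_primitive y r). Qed.

Lemma primitive_step y r :
  has_sum (fun e => (ini G e == y)%:R *
      (expR (- h * ell e) * primitive (ter G e) (r - ell e)))
    (primitive y r - Num.max 0 (1 - expR (- h * r))).
Proof.
have := @has_sum_walk_step y (prim_fun r) (primitive y r)
  (fun e => expR (- h * ell e) * primitive (ter G e) (r - ell e))
  (prim_fun_ge0 r).
rewrite {3}/prim_fun path_length_nil mulr0 expR0; apply; last exact: has_sum_primitive.
move=> e; apply: eq_has_sum (has_sumZ (expR_ge0 _) (has_sum_primitive _ _)) => p.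
rewrite /prim_term mulrCA; congr (_ * _).
rewrite /prim_fun maxr_pMr ?expR_ge0// mulr0 mulrBr -!expRD path_length_cons.
by congr (Num.max _ (expR _ - expR _)); ring.
Qed.

(** [count y] is nondecreasing, so its values at the two ends bracket the integral; the comparison
    is made for each walk separately. *)
Lemma primitive_increment y r r' : r <= r' ->
  (expR (- h * r) - expR (- h * r')) * count y r <=
    primitive y r' - primitive y r /\
  primitive y r' - primitive y r <=
    (expR (- h * r) - expR (- h * r')) * count y r'.
Proof.
move=> rr'.
have d0 : 0 <= expR (- h * r) - expR (- h * r').
  by rewrite subr_ge0 ler_expR !mulNr lerN2 ler_pM2l.
have mono p : prim_term y r p <= prim_term y r' p.
  by rewrite ler_wpM2l// /prim_fun ge_max !le_max lexx /=; apply/orP; right; lra.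
have hd := has_sumB (has_sum_primitive y r') (has_sum_primitive y r) mono.
have expE p t : (expR (- h * t) <= expR (- h * len p)) = (len p <= t).
  by rewrite ler_expR !mulNr lerN2 ler_pM2l.
split.
- apply: le_has_sum (has_sumZ d0 (has_sum_count y r)) hd => p.
  rewrite mulrCA -mulrBr ler_wpM2l// /prim_fun -(expE p r).
  case: (lerP (expR (- h * r)) (expR (- h * len p))) => /= ab.
    by rewrite !max_r; lra.
  by rewrite mulr0 [X in _ - X]max_l ?subr0 ?prim_fun_ge0//; lra.
- apply: le_has_sum hd (has_sumZ d0 (has_sum_count y r')) => p.
  rewrite [leRHS]mulrCA -mulrBr ler_wpM2l// /prim_fun -(expE p r').
  case: (lerP (expR (- h * r')) (expR (- h * len p))) => /= ab.
    rewrite mulr1 [X in X - _]max_r ?subr_ge0//.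
    have : expR (- h * len p) - expR (- h * r) <=
      Num.max 0 (expR (- h * len p) - expR (- h * r)) by rewrite le_max lexx orbT.
    lra.
  by rewrite mulr0 !max_l ?subr0//; lra.
Qed.

Lemma primitive_mono y r r' : r <= r' -> primitive y r <= primitive y r'.
Proof.
move=> rr'; rewrite -subr_ge0; have [le1 _] := primitive_increment y rr'.
apply: le_trans le1; rewrite mulr_ge0 ?count_ge0//.
by rewrite subr_ge0 ler_expR !mulNr lerN2 ler_pM2l.
Qed.

Definition scaled y r := expR (- h * r) * count y r.

Lemma scaled_ge0 y r : 0 <= scaled y r.
Proof. by rewrite mulr_ge0 ?expR_ge0 ?count_ge0. Qed.

Lemma scaled_step y r :
  has_sum (fun e => (ini G e == y)%:R *
      (expR (- h * ell e) * scaled (ter G e) (r - ell e)))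
    (scaled y r - expR (- h * r) * (0 <= r)%R%:R).
Proof.
rewrite /scaled -mulrBr.
apply: eq_has_sum (has_sumZ (expR_ge0 _) (count_step y r)) => e.
rewrite mulrCA; congr (_ * _); rewrite mulrA -expRD; congr (expR _ * _); ring.
Qed.

(** Monotonicity of [count y] limits the decay of [scaled y] to the rate [h]. This one-sided
    continuity later extends estimates from nearby points to whole windows. *)
Lemma scaled_slow y r r' : r <= r' ->
  expR (- h * (r' - r)) * scaled y r <= scaled y r'.
Proof.
move=> rr'; rewrite /scaled mulrA -expRD.
have -> : - h * (r' - r) + - h * r = - h * r' by ring.
by rewrite ler_wpM2l ?expR_ge0// count_mono.
Qed.

Lemma scaled_increment y r r' : r <= r' ->
  (1 - expR (- h * (r' - r))) * scaled y r <= primitive y r' - primitive y r /\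
  primitive y r' - primitive y r <= (expR (h * (r' - r)) - 1) * scaled y r'.
Proof.
move=> rr'.
have -> : (1 - expR (- h * (r' - r))) * scaled y r =
    (expR (- h * r) - expR (- h * r')) * count y r.
  rewrite /scaled mulrA mulrBl mul1r -expRD.
  by congr ((_ - expR _) * _); ring.
have -> : (expR (h * (r' - r)) - 1) * scaled y r' =
    (expR (- h * r) - expR (- h * r')) * count y r'.
  rewrite /scaled mulrA mulrBl mul1r -expRD.
  by congr ((expR _ - _) * _); ring.
exact: primitive_increment.
Qed.

Variable w : V -> R.
Hypothesis w_gt0 : forall z, 0 < w z.
Hypothesis w_eigen : forall z, has_sum (inflow G ell h w z) (w z).

Definition flow e := w (ini G e) * expR (- h * ell e).

Lemma flow_gt0 e : 0 < flow e.
Proof. by rewrite mulr_gt0 ?expR_gt0. Qed.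

(* The increments of [\sum_y w y * primitive y] are conserved because [w] is a left eigenvector. *)
Lemma conservation r :
  has_sum (fun e => flow e *
      (primitive (ter G e) r - primitive (ter G e) (r - ell e)))
    ((\sum_z w z) * Num.max 0 (1 - expR (- h * r))).
Proof.
(* [X1] expands the [w]-weighted sum of [primitive z r] over incoming edges by the eigenvector
   equation, [X2] over outgoing edges by the renewal equation; the difference leaves only the
   inhomogeneous term. *)
have X1 := has_sum_sum (fun z => primitive_ge0 z r) w_eigen.
have X2 := has_sum_sum (fun z => ltW (w_gt0 z)) (fun z => primitive_step z r).
have E1 e : \sum_z primitive z r * inflow G ell h w z e =
    flow e * primitive (ter G e) r.
  rewrite -(sum_indicator (ter G e) (fun z => flow e * primitive z r)).
  by apply: eq_bigr => z _; rewrite /inflow -/(flow e) mulrCA [_ * flow e]mulrC.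
have E2 e : \sum_z w z * ((ini G e == z)%:R *
      (expR (- h * ell e) * primitive (ter G e) (r - ell e))) =
    flow e * primitive (ter G e) (r - ell e).
  rewrite -[RHS]mulrA -(sum_indicator (ini G e) (fun z => w z * (expR (- h * ell e) *
    primitive (ter G e) (r - ell e)))).
  by apply: eq_bigr => z _; rewrite mulrCA.
have := has_sumB (eq_has_sum E1 X1) (eq_has_sum E2 X2).
have -> : \sum_z primitive z r * w z -
    \sum_z w z * (primitive z r - Num.max 0 (1 - expR (- h * r))) =
    (\sum_z w z) * Num.max 0 (1 - expR (- h * r)).
  rewrite -sumrB mulr_suml; apply: eq_bigr => z _; ring.
move=> H; apply: eq_has_sum (H _) => e; first by rewrite mulrBr.
rewrite ler_wpM2l ?(ltW (flow_gt0 e))// primitive_mono// gerBl ltW//.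
Qed.

End Counting.

(** * Real analysis *)

Section RealLemmas.
Variable R : realType.
Implicit Types (x r t : R).

Lemma expRN_lower x : 0 <= x -> x - x ^+ 2 <= 1 - expR (- x).
Proof.
move=> x0; rewrite expRN lerBrDr.
have e1 : (expR x)^-1 <= (1 + x)^-1.
  by rewrite lef_pV2 ?posrE ?expR_gt0 ?expR_ge1Dx//; lra.
have e2 : (1 + x)^-1 <= 1 - x + x ^+ 2.
  have x1 : 0 < 1 + x by lra.
  rewrite -[leLHS]mul1r ler_pdivrMr//.
  have : 0 <= x ^+ 3 by rewrite exprn_ge0.
  nra.
lra.
Qed.

Lemma expR_upper x : 0 <= x -> x <= 2^-1 -> expR x - 1 <= x + 2 * x ^+ 2.
Proof.
move=> x0 x1; rewrite lerBlDr -[x in expR x]opprK expRN.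
have e1 : (expR (- x))^-1 <= (1 - x)^-1.
  by rewrite lef_pV2 ?posrE ?expR_gt0 ?expR_ge1Dx//; lra.
have e2 : (1 - x)^-1 <= 1 + x + 2 * x ^+ 2.
  have x2 : 0 < 1 - x by lra.
  rewrite -[leLHS]mul1r ler_pdivrMr//.
  have : 0 <= x ^+ 2 * (1 - 2 * x) by rewrite mulr_ge0 ?exprn_ge0//; lra.
  nra.
lra.
Qed.

(** Over [n] equal pieces the losses add up to at most [C * (b - a) ^+ 2 / n], which vanishes as [n]
    grows. *)
Lemma quadratic_increment (phi : R -> R) a b C eta : a <= b -> 0 < eta -> 0 <= C ->
  (forall r r', a <= r -> r <= r' -> r' <= b -> r' - r <= eta ->
     - C * (r' - r) ^+ 2 <= phi r' - phi r) ->
  phi a <= phi b.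
Proof.
move=> ab eta0 C0 H; rewrite leNgt; apply/negP => gap.
have g0 : 0 < phi a - phi b by rewrite subr_gt0.
(* The first summand makes the pieces no longer than [eta], the second makes the total loss smaller
   than the supposed gap. *)
pose X := (b - a) / eta + C * (b - a) ^+ 2 / (phi a - phi b).
have X1 : 0 <= (b - a) / eta by rewrite divr_ge0 ?subr_ge0// ltW.
have X2 : 0 <= C * (b - a) ^+ 2 / (phi a - phi b).
  by rewrite divr_ge0 ?(ltW g0)// mulr_ge0// exprn_ge0// subr_ge0.
pose n := (Num.truncn X).+1.
have nX : X < n%:R := truncnS_gt X.
have n0 : 0 < n%:R :> R by rewrite ltr0n.
pose s := (b - a) / n%:R.
have s0 : 0 <= s by rewrite divr_ge0 ?subr_ge0// ltW.
have sn : s * n%:R = b - a by rewrite /s divfK ?gt_eqF.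
have s_eta : s <= eta.
  by rewrite ler_pdivrMr// mulrC -ler_pdivrMr// ltW// (le_lt_trans _ nX)// lerDl.
have step k : (k <= n)%N -> phi a - k%:R * (C * s ^+ 2) <= phi (a + k%:R * s).
  elim: k => [|k IH] kn; first by rewrite !mul0r subr0 addr0.
  have kn' : k.+1%:R <= n%:R :> R by rewrite ler_nat.
  have := IH (ltnW kn).
  have ks : 0 <= k%:R * s by rewrite mulr_ge0.
  have kb : k.+1%:R * s <= b - a by rewrite -sn mulrC ler_wpM2l.
  rewrite -natr1 mulrDl mul1r in kb.
  have := H (a + k%:R * s) (a + k.+1%:R * s).
  rewrite -[k.+1%:R]natr1 !mulrDl !mul1r.
  have -> : a + (k%:R * s + s) - (a + k%:R * s) = s by ring.
  move=> /(_ _ _ _ s_eta) H'.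
  have := H' ltac:(lra) ltac:(lra) ltac:(lra).
  rewrite mulNr; lra.
have := step n (leqnn n).
have -> : a + n%:R * s = b by rewrite mulrC sn; ring.
have : n%:R * (C * s ^+ 2) < phi a - phi b.
  have -> : n%:R * (C * s ^+ 2) = C * (b - a) ^+ 2 / n%:R.
    by rewrite /s; field; rewrite gt_eqF.
  by rewrite ltr_pdivrMr// -ltr_pdivrMl// mulrC (le_lt_trans _ nX)// lerDr.
lra.
Qed.

Lemma limsup_ex (f : R -> R) B : (forall r, `|f r| <= B) -> exists M : R,
  (forall eps, 0 < eps -> exists R0, forall r, R0 <= r -> f r <= M + eps) /\
  (forall eps, 0 < eps -> forall R0, exists2 r, R0 <= r & M - eps <= f r).
Proof.
move=> fB; pose A := [set b | exists R0, forall r, R0 <= r -> f r <= b].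
have AB : A B by exists 0 => r _; rewrite (le_trans (ler_norm _)).
have lbA : lbound A (- B).
  move=> b [R0 /(_ R0 (lexx _))]; apply: le_trans.
  by have := fB R0; rewrite ler_norml => /andP[].
have iA : has_inf A by split; [exists B|exists (- B)].
exists (inf A); split=> eps eps0.
  have [b [R0 Hb] bM] := inf_adherent eps0 iA.
  by exists R0 => r /Hb fb; rewrite (le_trans fb)// ltW.
move=> R0; apply: contrapT => H.
suff : inf A <= inf A - eps by rewrite lerBrDr gerDl leNgt eps0.
apply: ge_inf; first exact: iA.2.
exists R0 => r R0r; rewrite leNgt; apply/negP => lt_f; apply: H.
by exists r => //; exact: ltW.
Qed.

Lemma fin_lbound_gt0 (I : finType) (d : I -> R) : (forall i, 0 < d i) ->
  exists2 c, 0 < c & forall i, c <= d i.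
Proof.
move=> d0; have s0 i : 0 <= (d i)^-1 by rewrite invr_ge0 ltW.
have S0 : 0 < 1 + \sum_i (d i)^-1 by rewrite ltr_pwDl// sumr_ge0.
exists (1 + \sum_i (d i)^-1)^-1; first by rewrite invr_gt0.
move=> i; rewrite -[leRHS]invrK lef_pV2 ?posrE ?invr_gt0//.
by rewrite (bigD1 i)//= addrCA lerDl addr_ge0// sumr_ge0.
Qed.

Lemma fin_ubound (I : finType) (d : I -> R) : exists c, forall i, d i <= c.
Proof.
exists (\sum_i `|d i|) => i; apply: le_trans (ler_norm _) _.
by rewrite (bigD1 i)//= lerDl sumr_ge0.
Qed.

(** * Eventual density of non-lattice additive semigroups *)

Section Semigroup.
Variable L : set R.
Hypothesis L0 : L 0.
Hypothesis LD : forall a b, L a -> L b -> L (a + b).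
Hypothesis L_ge0 : forall a, L a -> 0 <= a.
Hypothesis L_nonlattice : forall d : R, 0 < d ->
  exists2 a, L a & forall n : nat, a <> d * n%:R.

Lemma LMn a (n : nat) : L a -> L (n%:R * a).
Proof.
move=> La; elim: n => [|n IH]; first by rewrite mul0r.
by rewrite -natr1 mulrDl mul1r; exact: LD.
Qed.

Lemma L_pos_ex : exists2 l, L l & 0 < l.
Proof.
have [l Ll l0] := L_nonlattice ltr01; exists l => //.
rewrite lt_neqAle L_ge0// andbT eq_sym; apply/eqP => lE.
by apply: (l0 0%N); rewrite mulr0.
Qed.

(* The positive differences are closed under positive differences; if they had
   a positive infimum [d], it would be attained and [L] would lie in [d * N]. *)
Lemma small_difference delta : 0 < delta ->
  exists a b, [/\ L a, L b, 0 < b, 0 < a - b & a - b < delta].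
Proof.
move=> delta0; pose D := [set u | 0 < u /\ exists a b, [/\ L a, L b & u = a - b]].
have [l Ll l0] := L_pos_ex.
have iD : has_inf D.
  split; last by exists 0 => u [/ltW].
  by exists l; split => //; exists l, 0; rewrite subr0.
have DB u v : D u -> D v -> v < u -> D (u - v).
  move=> [u0 [a [b [La Lb uE]]]] [v0 [a' [b' [La' Lb' vE]]]] vu.
  split; first by rewrite subr_gt0.
  exists (a + b'), (b + a'); split; [exact: LD|exact: LD|rewrite uE vE; ring].
have [d_small|d_big] := ltP (inf D) delta.
  have e0 : 0 < delta - inf D by rewrite subr_gt0.
  have [u [u0 [a [b [La Lb uE]]]] ud] := inf_adherent e0 iD.
  exists (a + l), (b + l).
  have -> : a + l - (b + l) = u by rewrite uE; ring.
  split; [exact: LD|exact: LD| |by []|lra].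
  by rewrite ltr_wpDl// L_ge0.
have d0 : 0 < inf D by apply: lt_le_trans d_big.
have D_ge u : D u -> inf D <= u by apply: ge_inf; exact: iD.2.
(* Otherwise two distinct elements of [D] would lie between [inf D] and twice [inf D], and their
   difference would be an element below the infimum. *)
have DinfD : D (inf D).
  have [u Du ud] := inf_adherent d0 iD.
  have := D_ge _ Du; rewrite le_eqVlt => /orP[/eqP->//|du].
  have e0 : 0 < u - inf D by rewrite subr_gt0.
  have [v Dv vd] := inf_adherent e0 iD.
  have vu : v < u by lra.
  have := D_ge _ (DB _ _ Du Dv vu); have := D_ge _ Dv; lra.
have [_ [a [b [La Lb dE]]]] := DinfD.
have [c Lc cn] := L_nonlattice d0.
pose n := Num.truncn (c / inf D).
have c0 := L_ge0 Lc.
have /andP[n1 n2] : n%:R <= c / inf D < n.+1%:R.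
  by rewrite truncnS_gt andbT truncn_le// divr_ge0// ltW.
rewrite ler_pdivlMr// in n1; rewrite ltr_pdivrMr// -natr1 mulrDl mul1r in n2.
exfalso; have nc : n%:R * inf D < c.
  by rewrite lt_neqAle n1 andbT; apply/eqP => ncE; apply: (cn n); rewrite -ncE mulrC.
(* The remainder of [c] modulo [inf D] is again a difference of elements of [L], positive and below
   [inf D]. *)
have : D (c - n%:R * inf D).
  split; first by rewrite subr_gt0.
  exists (c + n%:R * b), (n%:R * a); split.
  - by apply: LD => //; exact: LMn.
  - exact: LMn.
  - rewrite [in LHS]dE; ring.
move=> /D_ge; lra.
Qed.

(** Replacing [k] copies of [b] by [a] in [n * b] advances by [k * g], where [g = a - b < delta].
    Once [n > b / g], these steps cover the whole stretch up to [(n + 1) * b]. *)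
Lemma eventually_dense delta : 0 < delta ->
  exists T, forall t, T <= t -> exists2 l, L l & t <= l < t + delta.
Proof.
move=> delta0; have [a [b [La Lb b0 g0 gd]]] := small_difference delta0.
set g := a - b in g0 gd.
pose N := (Num.truncn (b / g)).+1.
have Nb : b / g < N%:R := truncnS_gt _.
exists (N%:R * b) => t tT.
have t0 : 0 <= t by apply: le_trans tT; rewrite mulr_ge0// ltW.
pose n := Num.truncn (t / b).
have /andP[n1 n2] : n%:R <= t / b < n.+1%:R.
  by rewrite truncnS_gt andbT truncn_le// divr_ge0// ltW.
have Nn : (N <= n)%N.
  rewrite -ltnS -(@ltr_nat R); apply: le_lt_trans n2.
  by rewrite ler_pdivlMr.
rewrite ler_pdivlMr// in n1; rewrite ltr_pdivrMr// -natr1 mulrDl mul1r in n2.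
have tn0 : 0 <= t - n%:R * b by rewrite subr_ge0.
pose k := (Num.truncn ((t - n%:R * b) / g)).+1.
have /andP[k1 k2] : k.-1%:R <= (t - n%:R * b) / g < k%:R.
  by rewrite truncnS_gt andbT truncn_le// divr_ge0// ltW.
have kN : (k <= N)%N.
  rewrite -(prednK (isT : (0 < k)%N)) -(@ltr_nat R); apply: le_lt_trans k1 _.
  by apply: lt_trans Nb; rewrite ltr_pM2r ?invr_gt0//; lra.
have kn : (k <= n)%N := leq_trans kN Nn.
rewrite ler_pdivlMr// in k1; rewrite ltr_pdivrMr// in k2.
exists ((n - k)%:R * b + k%:R * a); first by apply: LD; exact: LMn.
have -> : (n - k)%:R * b + k%:R * a = n%:R * b + k%:R * g.
  by rewrite natrB// /g; ring.
have kE : k%:R = k.-1%:R + 1 :> R by rewrite natr1.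
apply/andP; split; first lra.
by rewrite kE mulrDl mul1r; lra.
Qed.

End Semigroup.
End RealLemmas.

(** * Propagation of near-extremal values *)

Section Propagation.
Variables (R : realType) (V : finType) (E : countType).
Variables (G : ograph V E) (ell : E -> R).
Implicit Types (p q : seq E) (e : E) (y z : V) (r t : R) (S : {fset E}).
Hypothesis V_nonempty : (0 < #|V|)%N.
Hypothesis ell_gt0 : forall e, 0 < ell e.
Hypothesis strong : forall y z, exists2 p, walk G y p z & p != [::].
Hypothesis nonlattice : forall y (d : R), 0 < d ->
  exists2 p, walk G y p y & forall n : nat, path_length ell p <> d * n%:R.
Variables (h : R) (w : V -> R).
Hypothesis w_gt0 : forall z, 0 < w z.
Hypothesis w_eigen : forall z, has_sum (inflow G ell h w z) (w z).

(** The hypotheses on [F] are met twice: by [scaled] with its limsups, and by its negation with the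
    negated liminfs. Hence [F_step] is one-sided, up to [eps], over a finite set of edges. *)
Variables (F : V -> R -> R) (B : R) (M : V -> R).
Hypothesis F_bound : forall z r, `|F z r| <= B.
Hypothesis F_step : forall S0 eps, 0 < eps -> exists2 S, (S0 `<=` S)%fset &
  exists R0, forall y r, R0 <= r ->
    F y r <= \sum_(e <- S) (ini G e == y)%:R *
      (expR (- h * ell e) * F (ter G e) (r - ell e)) + eps.
Hypothesis M_upper : forall z eps, 0 < eps ->
  exists R0, forall r, R0 <= r -> F z r <= M z + eps.
Hypothesis M_freq : forall z eps, 0 < eps -> forall R0,
  exists2 r, R0 <= r & M z - eps <= F z r.

Local Notation flow := (flow G ell h w).
Local Notation len := (path_length ell).

Let flow_pos e : 0 < flow e := flow_gt0 G ell h w_gt0 e.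

Lemma has_sum_flow (c : V -> R) : (forall z, 0 <= c z) ->
  has_sum (fun e => flow e * c (ter G e)) (\sum_z c z * w z).
Proof.
move=> c0; apply: eq_has_sum (has_sum_sum c0 w_eigen) => e.
rewrite -(sum_indicator (ter G e) (fun z => flow e * c z)).
by apply: eq_bigr => z _; rewrite /inflow -/(flow e) mulrCA [_ * flow e]mulrC.
Qed.

Let B_ge0 : 0 <= B.
Proof.
have /card_gt0P[y _] := V_nonempty.
exact: le_trans (normr_ge0 _) (F_bound y 0).
Qed.

Lemma M_lower_bound z : 0 <= M z + B.
Proof.
rewrite -lerBlDr sub0r; apply/ler_addgt0Pr => eps eps0.
have [R0 /(_ R0 (lexx _))] := M_upper z eps0; apply: le_trans.
by have := F_bound z R0; rewrite ler_norml => /andP[].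
Qed.

Lemma sum_flow_le S : \sum_(e <- S) flow e <= \sum_z w z.
Proof.
have := has_sum_ge_fset S (@has_sum_flow (fun=> 1) (fun=> ler01)).
by under eq_bigr do rewrite mulr1; under [leRHS]eq_bigr do rewrite mul1r.
Qed.

(* When [F y] nearly attains its limsup at [r], so do all the terms of the
   weighted average defining [F y r]: otherwise pairing with the left
   eigenvector [w] would give [w M < w M]. *)
Lemma propagate_edge e0 eps : 0 < eps ->
  exists2 delta, 0 < delta & exists R0, forall r, R0 <= r ->
    M (ini G e0) - delta <= F (ini G e0) r ->
    M (ter G e0) - eps <= F (ter G e0) (r - ell e0).
Proof.
move=> eps0; pose W := \sum_z w z.
have W0 : 0 <= W by apply: sumr_ge0 => z _; exact: ltW.
(* The errors total at most [kappa * (3 * W + B)]: [kappa * W] each from truncation, near-maximality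
   and the upper bounds on the terms, and [kappa * B] from the flow outside [S]. *)
pose kappa := flow e0 * eps / (3 * W + B + 1).
have den0 : 0 < 3 * W + B + 1 by rewrite ltr_wpDl// addr_ge0// mulr_ge0.
have kappa0 : 0 < kappa by rewrite divr_gt0// mulr_gt0.
have kappaE : kappa * (3 * W + B) < flow e0 * eps.
  rewrite -[ltRHS](_ : kappa * (3 * W + B + 1) = _).
    by rewrite ltr_pM2l// ltrDl.
  by rewrite /kappa divfK ?gt_eqF.
have sumflow : has_sum flow W.
  have -> : W = \sum_z 1 * w z by apply: eq_bigr => z _; rewrite mul1r.
  apply: eq_has_sum (@has_sum_flow (fun=> 1) (fun=> ler01)) => e.
  by rewrite mulr1.
have [S1 HS1] := has_sum_approx kappa0 sumflow.
have [S SS [R2 HR2]] := F_step (e0 |` S1)%fset kappa0.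
have e0S : e0 \in S by apply: (fsubsetP SS); rewrite fset1U1.
have lowS : W - kappa < \sum_(e <- S) flow e.
  by apply: HS1; apply: fsubset_trans SS; exact: fsubsetU1.
have /choice[R1 HR1] : forall z, exists R0, forall r, R0 <= r ->
    F z r <= M z + kappa by move=> z; exact: M_upper.
have [R1' HR1'] := fin_ubound R1.
pose L := \sum_(e <- S) ell e.
have ellL e : e \in S -> ell e <= L.
  by move=> eS; rewrite /L (big_fsetD1 e)//= lerDl sumr_ge0// => e' _; exact: ltW.
pose R0 := Num.max R2 (R1' + L).
have R02 : R2 <= R0 by rewrite le_max lexx.
have R01 : R1' + L <= R0 by rewrite le_max lexx orbT.
exists kappa => //; exists R0 => r rR0 near_max.
rewrite leNgt; apply/negP => too_small.
(* Every vertex gets its own time of near-maximality, with [r] itself at the origin of [e0]; the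
   vertexwise inequalities are then weighted by [w] and added. *)
have /choice[rho Hrho] : forall y, exists t, [/\ R0 <= t, M y - kappa <= F y t &
    y = ini G e0 -> t = r].
  move=> y; have [->|yN] := eqVneq y (ini G e0); first by exists r.
  have [t tR0 tM] := M_freq y kappa0 R0.
  by exists t; split => // yE; rewrite yE eqxx in yN.
have term e : e \in S ->
    F (ter G e) (rho (ini G e) - ell e) <=
    M (ter G e) + kappa - (e == e0)%:R * eps.
  move=> eS; have [rR _ rE] := Hrho (ini G e).
  have [eE|_] := eqVneq e e0.
    move: rE; rewrite eE => /(_ erefl) ->; rewrite mul1r; move: too_small; lra.
  rewrite mul0r subr0; apply: HR1.
  have := ellL e eS; have := HR1' (ter G e); lra.
have main : \sum_z w z * (M z - 2 * kappa) <=
    \sum_(e <- S) flow e * (M (ter G e) + kappa - (e == e0)%:R * eps).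
  apply: le_trans (_ : \sum_z w z * \sum_(e <- S) (ini G e == z)%:R *
      (expR (- h * ell e) * F (ter G e) (rho z - ell e)) <= _).
    apply: ler_sum => z _; rewrite ler_pM2l//.
    have [rR Mz _] := Hrho z; have := HR2 z (rho z) (le_trans R02 rR); lra.
  under eq_bigr do rewrite big_distrr/=.
  rewrite exchange_big/= big_seq [leRHS]big_seq; apply: ler_sum => e eS.
  rewrite (eq_bigr (fun z => (ini G e == z)%:R * (w z * (expR (- h * ell e) *
    F (ter G e) (rho z - ell e))))); last by move=> z _; rewrite mulrCA.
  rewrite (sum_indicator (ini G e) (fun z => w z * (expR (- h * ell e) *
    F (ter G e) (rho z - ell e)))) mulrA -/(flow e) ler_pM2l//.
  exact: term.
(* [M z] may be negative; the shift by [B] makes the terms nonnegative, so a partial sum is bounded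
   by the full one. *)
have sumM : \sum_(e <- S) flow e * (M (ter G e) + B) <=
    \sum_z (M z + B) * w z.
  exact: has_sum_ge_fset (@has_sum_flow (fun z => M z + B) M_lower_bound).
have E1 : \sum_z w z * (M z - 2 * kappa) = \sum_z (M z + B) * w z -
    (2 * kappa + B) * W.
  rewrite /W big_distrr/= -sumrB; apply: eq_bigr => z _; ring.
have E2 : \sum_(e <- S) flow e * (M (ter G e) + kappa - (e == e0)%:R * eps) =
    \sum_(e <- S) flow e * (M (ter G e) + B) +
    (kappa - B) * \sum_(e <- S) flow e - flow e0 * eps.
  rewrite (_ : flow e0 * eps = \sum_(e <- S) (e == e0)%:R * (flow e * eps)).
    rewrite big_distrr/= -big_split/= -sumrB; apply: eq_bigr => e _; ring.
  rewrite (big_fsetD1 e0)//= eqxx mul1r big_seq big1 ?addr0// => e.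
  by rewrite !inE => /andP[/negbTE-> _]; rewrite mul0r.
have up := sum_flow_le S; rewrite -/W in up.
have : kappa * (\sum_(e <- S) flow e) <= kappa * W by rewrite ler_pM2l.
have : B * (W - kappa) <= B * \sum_(e <- S) flow e.
  by rewrite ler_wpM2l// ltW.
move: main sumM kappaE; rewrite E1 E2; lra.
Qed.

Lemma propagate_walk y p z eps : walk G y p z -> 0 < eps ->
  exists2 delta, 0 < delta & exists R0, forall r, R0 <= r ->
    M y - delta <= F y r -> M z - eps <= F z (r - len p).
Proof.
elim: p y => [|e p IH] y /=.
  move=> /eqP -> eps0; exists eps => //; exists 0 => r _.
  by rewrite path_length_nil subr0.
move=> /andP[/eqP <- wp] eps0.
have [d1 d10 [R1 HR1]] := IH _ wp eps0.
have [d2 d20 [R2 HR2]] := propagate_edge e d10.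
exists d2 => //; exists (Num.max R2 (R1 + ell e)) => r.
rewrite ge_max => /andP[rR2 rR1] /(HR2 r rR2) /(HR1 (r - ell e)).
rewrite path_length_cons opprD addrA; apply; lra.
Qed.

Lemma walk_lengths_dense y z delta : 0 < delta ->
  exists T, forall t, T <= t ->
    exists2 p, walk G y p z & t <= len p < t + delta.
Proof.
move=> delta0; have [q wq _] := strong y z.
pose L : set R := [set l | exists2 p, walk G y p y & l = len p].
have [||||T HT] := @eventually_dense R L _ _ _ _ delta delta0.
- by exists [::]; rewrite /= ?eqxx// path_length_nil.
- move=> _ _ [p wp ->] [p' wp' ->]; exists (p ++ p').
    by rewrite (walk_cat _ _ wp).
  by rewrite path_length_cat.
- by move=> _ [p _ ->]; exact: path_length_ge0.
- move=> d d0; have [p wp pd] := nonlattice y d0.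
  by exists (len p) => //; exists p.
exists (T + len q) => t tT; have [|l [p wp ->] /andP[lt1 lt2]] := HT (t - len q).
  by rewrite lerBrDr.
exists (p ++ q); first by rewrite (walk_cat _ _ wp).
by rewrite path_length_cat; apply/andP; split; lra.
Qed.

(** From one late time [r] at which [F y] is nearly maximal, walks of closely spaced lengths lead
    back to nearly maximal values throughout the window, at every vertex. These walks are finitely
    many and chosen before [r], so common thresholds exist. *)
Lemma windows eps delta K R1 : 0 < eps -> 0 < delta -> 0 < K ->
  exists2 rho, R1 <= rho & forall z t, rho - K <= t -> t <= rho ->
    exists t0, [/\ t - delta <= t0, t0 <= t & M z - eps <= F z t0].
Proof.
move=> eps0 delta0 K0; have /card_gt0P[y _] := V_nonempty.
pose d := delta / 2; have d0 : 0 < d by rewrite divr_gt0.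
have /choice[T_ HT_] : forall z, exists T, forall t, T <= t ->
    exists2 p, walk G y p z & t <= len p < t + d.
  by move=> z; exact: walk_lengths_dense.
have [T HT] := fin_ubound T_.
pose n := (Num.truncn (K / d)).+3.
have /choice[P HP] : forall i : V * 'I_n, exists p, walk G y p i.1 /\
    T + i.2%:R * d <= len p < T + i.2%:R * d + d.
  move=> [z j]; have [|p wp lp] := HT_ z (T + j%:R * d); last by exists p.
  by apply: le_trans (HT z) _; rewrite lerDl mulr_ge0// ltW.
have /choice[D HD] : forall i : V * 'I_n, exists D : R * R, 0 < D.1 /\
    forall r, D.2 <= r -> M y - D.1 <= F y r -> M i.1 - eps <= F i.1 (r - len (P i)).
  move=> i; have [D1 D10 [R0 HR0]] := propagate_walk (HP i).1 eps0.
  by exists (D1, R0).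
have [dl dl0 Hdl] := fin_lbound_gt0 (fun i => (HD i).1).
have [Rm HRm] := fin_ubound (fun i => (D i).2).
have [r rR rM] := M_freq y dl0 (Num.max Rm (R1 + T + d)).
move: rR; rewrite ge_max => /andP[rRm rR1].
exists (r - T - d); first lra.
move=> z t tK t_r.
pose x := (r - t - T) / d.
have x0 : 0 <= x by rewrite divr_ge0 ?(ltW d0)//; lra.
have /andP[j1 j2] : (Num.truncn x)%:R <= x < (Num.truncn x).+1%:R.
  by rewrite truncnS_gt andbT truncn_le.
have jn : ((Num.truncn x).+1 < n)%N.
  rewrite /n ltnS -ltnS -(@ltr_nat R) -natr1 -[X in _ < X]natr1 ltrD2r.
  apply: le_lt_trans j1 _; rewrite -natr1.
  apply: le_lt_trans (_ : K / d + 1 < _); last by rewrite ltrD2r truncnS_gt.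
  have -> : K / d + 1 = (K + d) / d by rewrite mulrDl divff ?gt_eqF.
  rewrite /x ler_pM2r ?invr_gt0//; lra.
(* The index is rounded up, so the walk is at least [r - t] long and [t0] lies to the left of
   [t]. *)
pose j := Ordinal jn.
have [_ /andP[l1 l2]] := HP (z, j); rewrite /= in l1 l2.
exists (r - len (P (z, j))).
rewrite ler_pdivlMr// in j1; rewrite ltr_pdivrMr// in j2.
have jE : (Num.truncn x).+1%:R * d = (Num.truncn x)%:R * d + d.
  by rewrite -natr1 mulrDl mul1r.
have dE : delta = d + d by rewrite /d; field.
rewrite jE in l1 l2.
split; first by rewrite dE; lra.
- by lra.
- apply: (HD (z, j)).2; first exact: le_trans (HRm _) rRm.
  by apply: le_trans rM; rewrite lerD2l lerN2.
Qed.

End Propagation.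

(** * The renewal theorem *)

Section Renewal.
Variables (R : realType) (V : finType) (E : countType).
Variables (G : ograph V E) (ell : E -> R).
Implicit Types (p q : seq E) (e : E) (y z : V) (r t : R) (S : {fset E}).
Hypothesis V_nonempty : (0 < #|V|)%N.
Hypothesis ell_gt0 : forall e, 0 < ell e.
Hypothesis H1 : forall s : R, 0 < s ->
  (\esum_(e in [set: E]) (expR (- s * ell e))%:E < +oo)%E.
Hypothesis strong : forall y z, exists2 p, walk G y p z & p != [::].
Hypothesis nonlattice : forall y (d : R), 0 < d ->
  exists2 p, walk G y p y & forall n : nat, path_length ell p <> d * n%:R.
Variables (h : R) (w : V -> R).
Hypothesis h_gt0 : 0 < h.
Hypothesis w_gt0 : forall z, 0 < w z.
Hypothesis w_eigen : forall z, has_sum (inflow G ell h w z) (w z).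

Local Notation flow := (flow G ell h w).
Local Notation len := (path_length ell).
Local Notation f := (scaled G ell h).
Local Notation J := (primitive G ell h).
Local Notation W := (\sum_z w z).

Let flow_pos e : 0 < flow e := flow_gt0 G ell h w_gt0 e.
Let f_ge0 y r : 0 <= f y r := scaled_ge0 G ell_gt0 H1 h y r.
Let f_incr := scaled_increment G ell_gt0 H1 h_gt0.
Let balance := conservation ell_gt0 H1 h_gt0 w_gt0 w_eigen.

Lemma edge_into z : exists e, ter G e = z.
Proof.
have [p] := strong z z; elim: p {1}z => // e p IH y /= /andP[_ wp] _.
case: p => [|e' p] in IH wp *; first by exists e; apply/eqP.
exact: IH wp isT.
Qed.

Let W_gt0 : 0 < W.
Proof.
have /card_gt0P[y _] := V_nonempty.
by rewrite (bigD1 y)//= ltr_pwDl// sumr_ge0// => z _; exact: ltW.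
Qed.

Lemma tail_factor r : 0 <= r ->
  Num.max 0 (1 - expR (- h * r)) = 1 - expR (- h * r).
Proof.
move=> r0; apply/max_idPr; rewrite subr_ge0 -expR0 ler_expR mulNr oppr_le0.
by rewrite mulr_ge0 ?(ltW h_gt0).
Qed.

Lemma balance_le r : W * Num.max 0 (1 - expR (- h * r)) <= W.
Proof.
rewrite ler_piMr ?(ltW W_gt0)// ge_max ler01 /= gerBl; exact: expR_ge0.
Qed.

(** Some edge [e] enters [z], and its single term in the conservation law at radius [r + ell e],
    whose total is at most [W], already bounds [f z r]. *)
Lemma scaled_bounded : exists2 B, 0 <= B & forall z r, f z r <= B.
Proof.
have /choice[B HB] : forall z, exists B, forall r, f z r <= B.
  move=> z; have [e ez] := edge_into z.
  pose c := 1 - expR (- h * ell e).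
  have c0 : 0 < c.
    rewrite subr_gt0 -expR0 ltr_expR mulNr oppr_lt0; exact: mulr_gt0.
  exists (W / (flow e * c)) => r.
  rewrite (ler_pdivlMr _ _ (mulr_gt0 (flow_pos e) c0)).
  have -> : f z r * (flow e * c) = flow e * (c * f z r) by ring.
  apply: le_trans (balance_le (r + ell e)).
  apply: le_trans (has_sum_ge_term e (balance _)).
  rewrite addrK ez ler_pM2l//.
  have [|+ _] := @f_incr z r (r + ell e); first by rewrite lerDl ltW.
  by rewrite addrAC subrr add0r.
have [c Hc] := fin_ubound B.
exists (Num.max 0 c); first by rewrite le_max lexx.
by move=> z r; rewrite (le_trans (HB z r))// le_max Hc orbT.
Qed.

(** By [scaled_increment], [J z] has slope at least [h * f z] up to a second-order error, which
    [quadratic_increment] removes. A negative [c], possible for [M z - eps], only needs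
    monotonicity. *)
Lemma primitive_lower z b s c : 0 <= s ->
  (forall t, b - s <= t -> t <= b -> c <= f z t) ->
  h * s * c <= J z b - J z (b - s).
Proof.
move=> s0 fc; have [c_neg|c0] := ltP c 0.
  apply: le_trans (_ : 0 <= _).
    by rewrite mulr_ge0_le0 ?(ltW c_neg)// mulr_ge0// ltW.
  by rewrite subr_ge0 primitive_mono// gerBl.
pose phi t := J z t - h * c * t.
suff : phi (b - s) <= phi b by rewrite /phi; lra.
apply: (@quadratic_increment R phi _ _ (c * h ^+ 2) 1) => //.
- by rewrite gerBl.
- by rewrite mulr_ge0// exprn_ge0// ltW.
move=> r r' br rr' r'b _; pose x := h * (r' - r).
have x0 : 0 <= x by rewrite mulr_ge0 ?subr_ge0// ltW.
have [le1 _] := f_incr z rr'; rewrite mulNr -/x in le1.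
have le2 := expRN_lower x0.
have le3 : (1 - expR (- x)) * c <= (1 - expR (- x)) * f z r.
  apply: ler_wpM2l; last by apply: fc; lra.
  by rewrite subr_ge0 -expR0 ler_expR oppr_le0.
have le4 : (x - x ^+ 2) * c <= (1 - expR (- x)) * c by rewrite ler_wpM2r.
have -> : phi r' - phi r = J z r' - J z r - x * c by rewrite /phi /x; ring.
have -> : - (c * h ^+ 2) * (r' - r) ^+ 2 = - (x ^+ 2 * c) by rewrite /x; ring.
lra.
Qed.

Lemma primitive_upper z b s c : 0 <= s ->
  (forall t, b - s <= t -> t <= b -> f z t <= c) ->
  J z b - J z (b - s) <= h * s * c.
Proof.
move=> s0 fc; have c0 : 0 <= c by apply: le_trans (f_ge0 z b) (fc _ _ _); lra.
pose phi t := h * c * t - J z t.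
suff : phi (b - s) <= phi b by rewrite /phi; lra.
(* The mesh [(2 * h)^-1] keeps [h * (r' - r)] at most [1 / 2], as [expR_upper] requires. *)
apply: (@quadratic_increment R phi _ _ (2 * c * h ^+ 2) (2 * h)^-1) => //.
- by rewrite gerBl.
- by rewrite invr_gt0 mulr_gt0.
- by apply: mulr_ge0; [exact: mulr_ge0|exact: sqr_ge0].
move=> r r' br rr' r'b small; pose x := h * (r' - r).
have x0 : 0 <= x by rewrite mulr_ge0 ?subr_ge0// ltW.
have x1 : x <= 2^-1.
  by move: small; rewrite invfM -ler_pdivrMr ?invr_gt0// invrK mulrC.
have [_ le1] := f_incr z rr'; rewrite -/x in le1.
have le2 := expR_upper x0 x1.
have le3 : (expR x - 1) * f z r' <= (expR x - 1) * c.
  apply: ler_wpM2l; last by apply: fc; lra.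
  by rewrite subr_ge0 -expR0 ler_expR.
have le4 : (expR x - 1) * c <= (x + 2 * x ^+ 2) * c by rewrite ler_wpM2r.
have -> : phi r' - phi r = x * c - (J z r' - J z r) by rewrite /phi /x; ring.
have -> : - (2 * c * h ^+ 2) * (r' - r) ^+ 2 = - (2 * x ^+ 2 * c).
  by rewrite /x; ring.
lra.
Qed.

(** Half of the exponential decay absorbs the factor [ell e], because [ell e * expR (- (h / 2) * ell
    e) <= 2 / h]. *)
Lemma has_sum_flow_ell : exists v, has_sum (fun e => flow e * ell e) v.
Proof.
have h20 : 0 < h / 2 by rewrite divr_gt0.
have [v kv] := has_sum_expR H1 h20.
have c0 : 0 <= W * (2 / h) by rewrite mulr_ge0 ?ltW// divr_gt0.
have [e|u ku _] := @has_sum_dom _ _ (fun e => flow e * ell e) _ _ _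
  (has_sumZ c0 kv); last by exists u.
rewrite mulr_ge0 ?(ltW (flow_pos e)) ?(ltW (ell_gt0 e))//=.
rewrite -mulrA -mulrA; apply: ler_pM; [exact: ltW| | |].
- by rewrite mulr_ge0 ?expR_ge0// ltW.
- by rewrite (bigD1 (ini G e))//= lerDl sumr_ge0// => z _; exact: ltW.
have -> : - h * ell e = - (h / 2) * ell e + - (h / 2 * ell e) by field.
rewrite expRD -mulrA [leRHS]mulrC ler_pM2l ?expR_gt0// expRN.
rewrite mulrC ler_pdivrMr ?expR_gt0//.
have := expR_ge1Dx (h / 2 * ell e) => le1.
apply: le_trans (_ : 2 / h * (1 + h / 2 * ell e) <= _).
  rewrite mulrDr mulr1 mulrA (_ : 2 / h * (h / 2) = 1); last first.
    by field; rewrite gt_eqF.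
  by rewrite mul1r lerDr divr_ge0// ltW.
by rewrite ler_pM2l// divr_gt0.
Qed.

Lemma scaled_step_upper S0 eps : 0 < eps -> exists2 S, (S0 `<=` S)%fset &
  exists R0, forall y r, R0 <= r ->
    f y r <= \sum_(e <- S) (ini G e == y)%:R *
      (expR (- h * ell e) * f (ter G e) (r - ell e)) + eps.
Proof.
move=> eps0; have [B B0 fB] := scaled_bounded.
have [v kv] := has_sum_expR H1 h_gt0.
pose d := eps / (2 * (B + 1)).
have B1 : 0 < B + 1 by rewrite ltr_wpDl.
have d0 : 0 < d by rewrite divr_gt0// mulr_gt0.
have Bd : B * d <= eps / 2.
  have -> : eps / 2 = (B + 1) * d by rewrite /d; field; rewrite gt_eqF.
  by rewrite ler_pM2r// lerDl.
have [S1 HS1] := has_sum_tail d0 kv.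
exists (S0 `|` S1)%fset; first exact: fsubsetUl.
exists ((2 / eps) / h) => y r rR.
have dom e : (ini G e == y)%:R * (expR (- h * ell e) * f (ter G e) (r - ell e)) <=
    B * expR (- h * ell e).
  apply: le_trans (_ : expR (- h * ell e) * f (ter G e) (r - ell e) <= _).
    by rewrite ler_piMl//; [rewrite mulr_ge0 ?expR_ge0|case: eqP].
  by rewrite mulrC ler_wpM2r ?expR_ge0.
have := HS1 _ (fsubsetUr S0 S1) B _ _ B0 dom (scaled_step G ell_gt0 H1 h y r).
have : expR (- h * r) * (0 <= r)%R%:R <= eps / 2.
  apply: le_trans (_ : expR (- h * r) <= _).
    by rewrite ler_piMr ?expR_ge0//; case: (0 <= r).
  rewrite mulNr expRN -[eps / 2]invrK lef_pV2 ?posrE ?expR_gt0//; last first.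
    by rewrite invr_gt0 divr_gt0.
  apply: le_trans (expR_ge1Dx _); rewrite invf_div.
  move: rR; rewrite ler_pdivrMr// mulrC; lra.
lra.
Qed.

(** For [- f] both the omitted edges and the inhomogeneous term have the favourable sign, so any
    finite set works. *)
Lemma scaled_step_lower S0 eps : 0 < eps -> exists2 S, (S0 `<=` S)%fset &
  exists R0, forall y r, R0 <= r ->
    - f y r <= \sum_(e <- S) (ini G e == y)%:R *
      (expR (- h * ell e) * - f (ter G e) (r - ell e)) + eps.
Proof.
move=> eps0; exists S0 => //; exists 0 => y r r0.
have := has_sum_ge_fset S0 (scaled_step G ell_gt0 H1 h y r).
have : 0 <= expR (- h * r) * (0 <= r)%R%:R by rewrite mulr_ge0 ?expR_ge0.
under [X in _ -> _ -> _ <= X + _]eq_bigr do rewrite !mulrN.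
rewrite sumrN; lra.
Qed.

(** * Equality and positivity of the upper and lower limits *)

Section Limits.
Variable B : R.
Hypothesis fB : forall z r, f z r <= B.
Variables M m : V -> R.
Hypothesis M_upper : forall z eps, 0 < eps ->
  exists R0, forall r, R0 <= r -> f z r <= M z + eps.
Hypothesis M_freq : forall z eps, 0 < eps -> forall R0,
  exists2 r, R0 <= r & M z - eps <= f z r.
Hypothesis m_lower : forall z eps, 0 < eps ->
  exists R0, forall r, R0 <= r -> m z - eps <= f z r.
Hypothesis m_freq : forall z eps, 0 < eps -> forall R0,
  exists2 r, R0 <= r & f z r <= m z + eps.

Let B_ge0 : 0 <= B.
Proof.
have /card_gt0P[y _] := V_nonempty.
exact: le_trans (f_ge0 y 0) (fB y 0).
Qed.

Lemma scaled_slow_bound z r r' : r <= r' -> f z r - B * (h * (r' - r)) <= f z r'.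
Proof.
move=> rr'; have x0 : 0 <= h * (r' - r) by rewrite mulr_ge0 ?subr_ge0// ltW.
apply: le_trans (scaled_slow G ell_gt0 H1 h z rr').
have := expR_ge1Dx (- (h * (r' - r))) => le1.
have : (1 - h * (r' - r)) * f z r <= expR (- (h * (r' - r))) * f z r.
  by rewrite ler_wpM2r.
have : (h * (r' - r)) * f z r <= (h * (r' - r)) * B by rewrite ler_wpM2l.
rewrite mulNr; lra.
Qed.

Lemma window_M eps K R1 : 0 < eps -> 0 < K -> exists2 rho, R1 <= rho &
  forall z t, rho - K <= t -> t <= rho -> M z - eps <= f z t.
Proof.
move=> eps0 K0; have e20 : 0 < eps / 2 by rewrite divr_gt0.
pose delta := eps / 2 / (B * h + 1).
have Bh0 : 0 < B * h + 1 by rewrite ltr_wpDl// mulr_ge0// ltW.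
have delta0 : 0 < delta by rewrite divr_gt0.
have Bhd : B * (h * delta) <= eps / 2.
  rewrite mulrA -[leRHS](_ : (B * h + 1) * delta = _).
    by rewrite ler_pM2r// lerDl.
  by rewrite /delta mulrC divfK ?gt_eqF.
have Fb z r : `|f z r| <= B by rewrite ger0_norm.
have [rho R1rho Hrho] := windows V_nonempty ell_gt0 strong nonlattice w_gt0 w_eigen
  Fb scaled_step_upper M_upper M_freq R1 e20 delta0 K0.
exists rho => // z t tK trho; have [t0 [t01 t02 Mf]] := Hrho z t tK trho.
have := scaled_slow_bound z t02.
have : B * (h * (t - t0)) <= B * (h * delta).
  rewrite ler_wpM2l// ler_pM2l//; lra.
lra.
Qed.

Lemma window_m eps K R1 : 0 < eps -> 0 < K -> exists2 rho, R1 <= rho &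
  forall z t, rho - K <= t -> t <= rho -> f z t <= m z + eps.
Proof.
move=> eps0 K0; have e20 : 0 < eps / 2 by rewrite divr_gt0.
pose delta := eps / 2 / (B * h + 1).
have Bh0 : 0 < B * h + 1 by rewrite ltr_wpDl// mulr_ge0// ltW.
have delta0 : 0 < delta by rewrite divr_gt0.
have Bhd : B * (h * delta) <= eps / 2.
  rewrite mulrA -[leRHS](_ : (B * h + 1) * delta = _).
    by rewrite ler_pM2r// lerDl.
  by rewrite /delta mulrC divfK ?gt_eqF.
have Fb z r : `|- f z r| <= B by rewrite normrN ger0_norm.
have Mu z d : 0 < d -> exists R0, forall r, R0 <= r -> - f z r <= - m z + d.
  by move=> /(m_lower z)[R0 HR0]; exists R0 => r /HR0; lra.
have Mf z d : 0 < d -> forall R0, exists2 r, R0 <= r & - m z - d <= - f z r.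
  move=> /(m_freq z) + R0 => /(_ R0)[r rR fr]; exists r => //; lra.
have [rho R1rho Hrho] := windows V_nonempty ell_gt0 strong nonlattice w_gt0 w_eigen
  Fb scaled_step_lower Mu Mf (R1 + delta) e20 delta0 K0.
(* Small values of [f] carry over to earlier times only, so the nearby point must lie to the right
   of [t]: the window is shifted by [delta] and queried at [t + delta]. *)
exists (rho - delta); first lra.
move=> z t tK trho; have [||t0 [t01 t02 Mft]] := Hrho z (t + delta); [lra|lra|].
have tt0 : t <= t0 by lra.
have := scaled_slow_bound z tt0.
have : B * (h * (t0 - t)) <= B * (h * delta).
  rewrite ler_wpM2l// ler_pM2l//; lra.
lra.
Qed.

(** The part over [S] of the conserved sum if each [f z] were constantly [c z]: [J z] would then
    grow by [h * ell e * c z] over a length [ell e]. *)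
Let Psi (c : V -> R) S := \sum_(e <- S) flow e * (h * ell e * c (ter G e)).

Lemma ell_le_sum S e : e \in S -> ell e <= \sum_(e' <- S) ell e' + 1.
Proof.
move=> eS; rewrite (big_fsetD1 e)//= -addrA lerDl addr_ge0//.
by apply: sumr_ge0 => e' _; exact: ltW.
Qed.

Let Psi_shift c S eps :
  Psi (fun z => c z + eps) S = Psi c S + eps * Psi (fun=> 1) S.
Proof.
by rewrite /Psi big_distrr/= -big_split/=; apply: eq_bigr => e _; ring.
Qed.

Let Psi1_ge0 S : 0 <= Psi (fun=> 1) S.
Proof.
apply: sumr_ge0 => e _; rewrite mulr_ge0 ?(ltW (flow_pos e))// mulr1.
by rewrite mulr_ge0 ?(ltW h_gt0) ?(ltW (ell_gt0 e)).
Qed.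

(** On a window longer than every edge of [S] all [f z] are at least [M z - eps], so the conserved
    sum, at most [W], dominates [Psi] of these lower bounds. *)
Lemma Psi_M_le S : Psi M S <= W.
Proof.
apply/ler_addgt0Pr => eps0 eps00.
have P1 := Psi1_ge0 S.
pose eps := eps0 / (Psi (fun=> 1) S + 1).
have eps_gt0 : 0 < eps by rewrite divr_gt0// ltr_wpDl.
have epsP : eps * Psi (fun=> 1) S <= eps0.
  rewrite /eps mulrAC ler_pdivrMr ?ltr_wpDl// ler_pM2l// lerDl//.
have K0 : 0 < \sum_(e <- S) ell e + 1.
  by rewrite ltr_wpDl// sumr_ge0// => e _; exact: ltW.
have [rho _ Hrho] := window_M 0 eps_gt0 K0.
have : Psi (fun z => M z - eps) S <= W.
  apply: le_trans (balance_le rho).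
  apply: le_trans (has_sum_ge_fset S (balance rho)).
  rewrite /Psi big_seq [leRHS]big_seq; apply: ler_sum => e eS.
  rewrite ler_pM2l//; apply: primitive_lower; first exact: ltW.
  move=> t t1 t2; apply: Hrho => //; have := ell_le_sum eS; lra.
rewrite Psi_shift; lra.
Qed.

(** On a window all [f z] are at most [m z + eps]. The edges outside [S] now matter: boundedness of
    [f] and summability of [flow e * ell e] make them negligible uniformly in the radius. The tail,
    the window error and [W * expR (- h * rho)] each cost at most [eta / 4]. *)
Lemma Psi_m_ge eta S0 : 0 < eta -> exists2 S, (S0 `<=` S)%fset & W - eta <= Psi m S.
Proof.
move=> eta0; have [v kv] := has_sum_flow_ell.
have hB0 : 0 <= h * B by rewrite mulr_ge0// ltW.
pose d := eta / 4 / (h * B + 1).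
have d0 : 0 < d by rewrite !divr_gt0// ltr_wpDl.
have hBd : h * B * d <= eta / 4.
  by rewrite /d mulrA ler_pdivrMr ?ltr_wpDl// [leLHS]mulrC ler_pM2l ?divr_gt0// lerDl.
have [S1 HS1] := has_sum_tail d0 kv.
exists (S0 `|` S1)%fset; first exact: fsubsetUl.
set S := (S0 `|` S1)%fset; have P1 := Psi1_ge0 S.
pose eps := eta / 4 / (Psi (fun=> 1) S + 1).
have eps_gt0 : 0 < eps by rewrite !divr_gt0// ltr_wpDl.
have epsP : eps * Psi (fun=> 1) S <= eta / 4.
  by rewrite /eps mulrAC ler_pdivrMr ?ltr_wpDl// ler_pM2l ?divr_gt0// lerDl.
have K0 : 0 < \sum_(e <- S) ell e + 1.
  by rewrite ltr_wpDl// sumr_ge0// => e _; exact: ltW.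
pose R1 := W / (eta / 4) / h.
have R10 : 0 <= R1 by rewrite !divr_ge0// ?(ltW W_gt0)// ltW.
have [rho R1rho Hrho] := window_m R1 eps_gt0 K0.
have rho0 : 0 <= rho by apply: le_trans R1rho.
have small : W * expR (- h * rho) <= eta / 4.
  rewrite mulNr expRN ler_pdivrMr ?expR_gt0// mulrC -ler_pdivrMr ?divr_gt0//.
  apply: le_trans (expR_ge1Dx _).
  move: R1rho; rewrite /R1 ler_pdivrMr// mulrC; lra.
have dom e : flow e * (J (ter G e) rho - J (ter G e) (rho - ell e)) <=
    h * B * (flow e * ell e).
  rewrite mulrCA ler_pM2l// mulrAC; apply: primitive_upper; first exact: ltW.
  by move=> t _ _; exact: fB.
have := HS1 S (fsubsetUr S0 S1) _ _ _ hB0 dom (balance rho).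
rewrite tail_factor// mulrBr mulr1 => le1.
have : \sum_(e <- S) flow e * (J (ter G e) rho - J (ter G e) (rho - ell e)) <=
    Psi (fun z => m z + eps) S.
  rewrite /Psi big_seq [leRHS]big_seq; apply: ler_sum => e eS.
  rewrite ler_pM2l//; apply: primitive_upper; first exact: ltW.
  move=> t t1 t2; apply: Hrho => //; have := ell_le_sum eS; lra.
rewrite Psi_shift; lra.
Qed.

Lemma m_le_M z : m z <= M z.
Proof.
apply/ler_addgt0Pr => eps eps0; have e20 : 0 < eps / 2 by rewrite divr_gt0.
have [R1 HR1] := m_lower z e20; have [R2 HR2] := M_upper z e20.
pose r := Num.max R1 R2.
have := HR1 r; have := HR2 r; rewrite !le_max !lexx orbT => /(_ isT) + /(_ isT).
lra.
Qed.

(** From [Psi M S <= W <= Psi m S + eta] and [m <= M], the nonnegative termwise differences add up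
    to at most [eta]. A gap at the end of [e0] would alone contribute twice [eta]. *)
Lemma M_eq_m z : M z = m z.
Proof.
apply/eqP; rewrite eq_le m_le_M andbT; have [e0 <-] := edge_into z.
rewrite -subr_le0 leNgt; apply/negP => gap.
pose eta := flow e0 * (h * ell e0 * (M (ter G e0) - m (ter G e0))) / 2.
have pos : 0 < flow e0 * (h * ell e0 * (M (ter G e0) - m (ter G e0))).
  by apply: mulr_gt0 => //; apply: mulr_gt0 => //; exact: mulr_gt0.
have eta0 : 0 < eta by rewrite divr_gt0.
have [S eS le1] := Psi_m_ge [fset e0]%fset eta0.
have le2 := Psi_M_le S.
have : flow e0 * (h * ell e0 * (M (ter G e0) - m (ter G e0))) <= Psi M S - Psi m S.
  rewrite /Psi -sumrB (big_fsetD1 e0)/=; last by rewrite -fsub1set.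
  rewrite -!mulrBr lerDl sumr_ge0// => e _; rewrite -!mulrBr.
  rewrite mulr_ge0 ?(ltW (flow_pos e))// mulr_ge0 ?subr_ge0 ?m_le_M//.
  by rewrite mulr_ge0 ?(ltW h_gt0) ?(ltW (ell_gt0 e)).
rewrite /eta in le1; lra.
Qed.

Lemma m_pos_ex : exists z, 0 < m z.
Proof.
apply: contrapT => /forallNP H.
have W20 : 0 < W / 2 by rewrite divr_gt0.
have [S _] := Psi_m_ge fset0 W20.
have : Psi m S <= 0.
  rewrite /Psi; apply: sumr_le0 => e _; rewrite mulr_ge0_le0 ?(ltW (flow_pos e))//.
  rewrite mulr_ge0_le0//; first by rewrite mulr_ge0 ?(ltW h_gt0) ?(ltW (ell_gt0 e)).
  by rewrite leNgt; apply/negP; exact: H.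
have := W_gt0; lra.
Qed.

Lemma scaled_walk y p z r : walk G y p z ->
  expR (- h * len p) * f z (r - len p) <= f y r.
Proof.
elim: p y r => [|e p IH] y r /=.
  by move=> /eqP ->; rewrite path_length_nil mulr0 expR0 mul1r subr0.
move=> /andP[/eqP <- wp].
have := has_sum_ge_term e (scaled_step G ell_gt0 H1 h (ini G e) r).
rewrite eqxx mul1r => le1.
have le2 : 0 <= expR (- h * r) * (0 <= r)%R%:R by rewrite mulr_ge0 ?expR_ge0.
rewrite path_length_cons mulrDr expRD -mulrA opprD addrA.
have : expR (- h * ell e) * (expR (- h * len p) * f z (r - ell e - len p)) <=
    expR (- h * ell e) * f (ter G e) (r - ell e).
  by rewrite ler_pM2l ?expR_gt0// IH.
lra.
Qed.

(** A walk from [y] to a vertex with positive liminf transfers a positive share of it to [y]. *)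
Lemma M_pos y : 0 < M y.
Proof.
have [z mz] := m_pos_ex; have [p wp _] := strong y z.
have m20 : 0 < m z / 2 by rewrite divr_gt0.
have [R0 HR0] := m_lower z m20.
apply: lt_le_trans (_ : expR (- h * len p) * (m z / 2) <= _).
  by rewrite mulr_gt0 ?expR_gt0.
apply/ler_addgt0Pr => eps eps0; have [R1 HR1] := M_upper y eps0.
pose r := Num.max R1 (R0 + len p).
have rR1 : R1 <= r by rewrite le_max lexx.
have rR0 : R0 <= r - len p by rewrite lerBrDr le_max lexx orbT.
apply: le_trans (HR1 r rR1); apply: le_trans (scaled_walk r wp).
rewrite ler_pM2l ?expR_gt0//; have := HR0 _ rR0; lra.
Qed.

End Limits.

Lemma renewal y : exists2 C : R, 0 < C & (fun r : R => f y r) @ +oo%R --> C.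
Proof.
have [B B0 fB] := scaled_bounded.
have Fb z r : `|f z r| <= B by rewrite ger0_norm.
have Fb' z r : `|- f z r| <= B by rewrite normrN ger0_norm.
have /choice[M HM] := fun z => limsup_ex (Fb z).
have /choice[m' Hm] := fun z => limsup_ex (Fb' z).
pose m z := - m' z.
have m_lower z eps : 0 < eps -> exists R0, forall r, R0 <= r -> m z - eps <= f z r.
  by move=> /((Hm z).1)[R0 HR0]; exists R0 => r /HR0; rewrite /m; lra.
have m_freq z eps : 0 < eps -> forall R0, exists2 r, R0 <= r & f z r <= m z + eps.
  by move=> /((Hm z).2) + R0 => /(_ R0)[r rR fr]; exists r => //; rewrite /m; lra.
have M_upper z := (HM z).1; have M_freq z := (HM z).2.
exists (M y); first exact: (M_pos fB M_upper m_lower m_freq).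
have mM := M_eq_m fB M_upper M_freq m_lower m_freq y.
apply/cvgrPdist_le => eps eps0.
have [R1 HR1] := m_lower y _ eps0; have [R2 HR2] := M_upper y _ eps0.
near=> r; rewrite ler_norml.
have le2 : f y r <= M y + eps.
  by apply: HR2; near: r; apply: nbhs_pinfty_ge; exact: num_real.
have le1 : m y - eps <= f y r.
  by apply: HR1; near: r; apply: nbhs_pinfty_ge; exact: num_real.
by rewrite -mM in le1; apply/andP; split; lra.
Unshelve. all: by end_near.
Qed.

End Renewal.

(** * From walk counts to path counts and the entropy *)

Lemma has_sum_single (R : realType) (T : choiceType) (t0 : T) (c : R) : 0 <= c ->
  has_sum (fun t => (t == t0)%:R * c) c.
Proof.
move=> c0; split=> [t|]; first by rewrite mulr_ge0.
have := @esum_set1 R T t0 (fun=> c%:E) c0; rewrite esum_mkcond => <-.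
apply: eq_esum => t _; case: eqP => [->|tt0].
  by rewrite mem_set// mul1r.
by rewrite memNset// mul0r.
Qed.

Lemma counting_has_sum (R : realType) (T : choiceType) (A : set T) (v : R) :
  has_sum (fun t => `[< A t >]%:R) v -> counting A = v%:E.
Proof.
move=> Av; have finA : finite_set A.
  apply: contrapT => infA; pose n := (Num.truncn v).+1.
  have [S SA nS] := infinite_set_fset n infA.
  suff : n%:R <= v by rewrite leNgt truncnS_gt.
  apply: le_trans (has_sum_ge_fset S Av).
  rewrite big_seq (eq_bigr (fun=> 1)) => [|t tS]; last by rewrite asboolT//; exact: SA.
  by rewrite -big_seq big_const_seq count_predT iter_addr addr0 ler_nat.
rewrite /counting asboolT// -Av.2.
rewrite (_ : esum _ _ = \esum_(t in A) (1%:E : \bar R)); last first.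
  rewrite [RHS]esum_mkcond; apply: eq_esum => t _.
  by case: asboolP => At; [rewrite mem_set|rewrite memNset].
rewrite esum_fset// fsbig_finite//= sumEFin big_const_seq count_predT.
by rewrite iter_addr addr0.
Qed.

Lemma limf_esup_cvg (R : realType) (g : R -> \bar R) (l : R) (F : set_system R) :
  ProperFilter F ->
  (forall eps, 0 < eps ->
    \forall r \near F, ((l - eps)%:E <= g r <= (l + eps)%:E)%E) ->
  limf_esup g F = l%:E.
Proof.
move=> PF gl; apply/eqP; rewrite eq_le; apply/andP; split.
  apply/lee_addgt0Pr => eps eps0.
  apply: (@le_trans _ _ (ereal_sup (g @` [set r | (g r <= (l + eps)%:E)%E]))).
    apply: ereal_inf_lbound; exists [set r | (g r <= (l + eps)%:E)%E] => //.
    by apply: filterS (gl _ eps0) => r /andP[].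
  by apply: ge_ereal_sup => _ [r /= rl <-].
apply: le_ereal_inf_tmp => _ [A FA <-]; apply/lee_addgt0Pr => eps eps0.
have [r [/= Ar /andP[lr _]]] := filter_ex (filterI FA (gl _ eps0)).
rewrite -leeBlDr// -EFinB; apply: le_trans lr _.
by apply: ereal_sup_ubound; exists r.
Qed.

Lemma walk_from_path (V : finType) (E : countType) (G : ograph V E)
    (x : V) (e : E) (p : seq E) :
  walk_from G x (e :: p) = is_path G (e :: p) && path_starts G x (e :: p).
Proof.
rewrite /= andbC; congr (_ && _).
by elim: p e => [//|e' p IH] e /=; rewrite IH [ter G e == _]eq_sym.
Qed.

(** The subtracted indicator removes the empty walk, which [count] includes once [r >= 0] but which
    is not a path. *)
Lemma num_pathsE (R : realType) (V : finType) (E : countType)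
    (G : ograph V E) (ell : E -> R)
    (ell_gt0 : forall e : E, 0 < ell e)
    (H1 : forall s : R, 0 < s ->
      (\esum_(e in [set: E]) (expR (- s * ell e))%:E < +oo)%E)
    (x : V) (r : R) :
  num_paths G ell x r = (count G ell x r - (0 <= r)%R%:R)%:E.
Proof.
apply: counting_has_sum.
have r0 : 0 <= (0 <= r)%R%:R :> R by [].
have le_term p : (p == [::])%:R * (0 <= r)%R%:R <= count_term G ell x r p.
  case: p => [|e p]; first by rewrite /count_term path_length_nil.
  by rewrite mul0r count_term_ge0.
apply: eq_has_sum (has_sumB (has_sum_count G ell_gt0 H1 x r)
  (has_sum_single [::] r0) le_term) => -[|e p].
  rewrite /count_term path_length_nil subrr.
  by rewrite asboolF//; case.
rewrite mul0r subr0 /count_term walk_from_path -natrM mulnb -andbA; congr (_%:R).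
by congr nat_of_bool; apply/and3P/asboolP.
Qed.

Theorem theorem2p4 (R : realType) (V : finType) (E : countType)
    (G : ograph V E) (ell : E -> R)
    (V_nonempty : (0 < #|V|)%N)
    (G_connected : connected_ograph G)
    (ell_gt0 : forall e : E, 0 < ell e)
    (H1 : forall s : R, 0 < s ->
      (\esum_(e in [set: E]) (expR (- s * ell e))%:E < +oo)%E)
    (H2 : forall e e' : E,
      exists2 q : seq E, is_path G (e :: q) & last e q = e')
    (H3 : ~ exists2 d : R, 0 < d &
      forall c : seq E, is_closed_path G c ->
        exists n : nat, path_length ell c = d * n%:R)
    (x : V) :
  exists2 C : R, 0 < C &
    (fun r : R => (num_paths G ell x r
                   / expeR (volume_entropy G ell x * r%:E))%E)
      @ +oo%R --> C%:E.
Proof.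
have strong := strongly_connected G_connected H2 H3.
have nonlat := loops_nonlattice ell_gt0 G_connected H2 H3.
have [h [w [h0 Hw]]] := perron V_nonempty ell_gt0 H1 strong nonlat.
have w0 z := (Hw z).1; have w_eigen z := (Hw z).2.
have [C C0 cvC] := renewal V_nonempty ell_gt0 H1 strong nonlat h0 w0 w_eigen x.
pose N r := count G ell x r - (0 <= r)%R%:R.
(* Dropping the empty walk changes the scaled count by at most [expR (- h * r)], so the limit
   persists. *)
have cvN : (fun r : R => expR (- h * r) * N r) @ +oo%R --> C.
  apply/cvgrPdist_le => eps eps0; have e20 : 0 < eps / 2 by rewrite divr_gt0.
  near=> r.
  have rlarge : (2 / eps) / h <= r.
    by near: r; apply: nbhs_pinfty_ge; exact: num_real.
  have close : `|C - scaled G ell h x r| <= eps / 2.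
    by near: r; move/cvgrPdist_le: cvC; exact.
  have small : expR (- h * r) <= eps / 2.
    rewrite mulNr expRN -[eps / 2]invrK lef_pV2 ?posrE ?expR_gt0//; last first.
      by rewrite invr_gt0.
    apply: le_trans (expR_ge1Dx _); rewrite invf_div.
    move: rlarge; rewrite ler_pdivrMr// mulrC; lra.
  have b0 : 0 <= expR (- h * r) * (0 <= r)%R%:R by rewrite mulr_ge0 ?expR_ge0.
  have b1 : expR (- h * r) * (0 <= r)%R%:R <= expR (- h * r).
    by rewrite ler_piMr ?expR_ge0//; case: (0 <= r).
  rewrite /N mulrBr -/(scaled G ell h x r).
  move: close; rewrite !ler_norml => /andP[c1 c2]; apply/andP; split; lra.
have entropy : volume_entropy G ell x = h%:E.
  apply: limf_esup_cvg => eps eps0.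
  (* Eventually [expR (- h * r) * N r] lies between [C / 2] and [2 * C], so [ln (N r)] differs from
     [h * r] by at most [K], which is below [eps * r] for large [r]. *)
  pose K := `|ln (C / 2)| + `|ln (2 * C)|.
  near=> r.
  have r0 : 0 < r by near: r; apply: nbhs_pinfty_gt; exact: num_real.
  have rK : K / eps <= r by near: r; apply: nbhs_pinfty_ge; exact: num_real.
  have close : `|C - expR (- h * r) * N r| <= C / 2.
    by near: r; move/cvgrPdist_le: cvN; apply; rewrite divr_gt0.
  have [low high] : C / 2 <= expR (- h * r) * N r /\ expR (- h * r) * N r <= 2 * C.
    by move: close; rewrite ler_norml => /andP[c1 c2]; split; lra.
  have C20 : 0 < C / 2 by rewrite divr_gt0.
  have eN0 : 0 < expR (- h * r) * N r by apply: lt_le_trans low.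
  have N0 : 0 < N r by move: eN0; rewrite pmulr_rgt0 ?expR_gt0.
  have lnE : ln (expR (- h * r) * N r) = - h * r + ln (N r).
    by rewrite lnM ?posrE ?expR_gt0// expRK.
  have l1 : ln (C / 2) <= - h * r + ln (N r) by rewrite -lnE ler_ln ?posrE.
  have l2 : - h * r + ln (N r) <= ln (2 * C).
    by rewrite -lnE ler_ln ?posrE// mulr_gt0.
  have k1 : - K <= ln (C / 2).
    have := ler_norm (- ln (C / 2)); rewrite normrN /K.
    have := normr_ge0 (ln (2 * C)); lra.
  have k2 : ln (2 * C) <= K.
    have := ler_norm (ln (2 * C)); rewrite /K.
    have := normr_ge0 (ln (C / 2)); lra.
  have rK' : K <= eps * r by move: rK; rewrite ler_pdivrMr// mulrC.
  rewrite (num_pathsE G ell_gt0 H1) -/(N r) lne_EFin// -EFinM !lee_fin.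
  by rewrite mulrC ler_pdivlMr// ler_pdivrMr//; apply/andP; split; lra.
exists C => //; rewrite entropy.
rewrite (_ : (fun r : R => _) = EFin \o (fun r => expR (- h * r) * N r)).
  exact: cvg_comp cvN _.
apply/funext => r /=; rewrite (num_pathsE G ell_gt0 H1) -/(N r) inver.
by rewrite gt_eqF ?expR_gt0// -EFinM mulrC mulNr expRN.
Unshelve. all: by end_near.
Qed.
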